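(* Let $\mathcal{H}$ be a complex separable Hilbert space, let $U:\mathcal{H}\to\mathcal{H}$ be unitary, let $\psi\in\mathcal{H}$ with $\|\psi\|=1$, let $d\ge 1$ be an integer, and let $(\varphi_n)_{n\in A}$ be an orthonormal basis of $\mathcal{H}$ indexed by $A=\mathbb{Z}_+^d$ or $A=\mathbb{Z}^d$. Let $\mu_\psi^U$ be the spectral measure of $U$ and $\psi$. Then for every $p>0$, $$\tilde\beta_\psi^+(p)\ \ge\ \frac{\dim_{\mathrm P}^+(\mu_\psi^U)}{d}.$$
   Context: Notation: $\mathbb{Z}_+=\{1,2,3,\dots\}$; for $n\in A$, $|n|=|n_1|+\dots+|n_d|$. $\partial\mathbb{D}=\{z\in\mathbb{C}:|z|=1\}$. Spectral measure: $\mu_\psi^U$ is the Borel measure on $\partial\mathbb{D}$ with $\langle\psi,f(U)\psi\rangle=\int f\,d\mu_\psi^U$ for all bounded Borel $f$ on $\partial\mathbb{D}$. Dynamics: $\psi(k)=U^k\psi$, $a_\psi(n,k)=|\langle\varphi_n,\psi(k)\rangle|^2$, and $|X|^p_\psi(k)=\sum_{n\in A}(|n|^p+1)\,a_\psi(n,k)\in[1,\infty]$. For integers $K\ge1$, $\langle|X|^p_\psi\rangle(K)=\frac1K\sum_{k=0}^{K-1}|X|^p_\psi(k)$. The upper time-averaged transport exponent is $$\tilde\beta_\psi^+(p)=\limsup_{K\to\infty}\frac{\log\big(\langle|X|^p_\psi\rangle(K)\big)}{p\log K}.$$ Packing measure and dimension: for $S\subseteq\partial\mathbb{D}$ and $\delta>0$,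 a $\delta$-packing with centers in $S$ is a countable collection $\{I_j\}$ of mutually disjoint closed arcs of $\partial\mathbb{D}$, each of length at most $\delta$ and with center in $S$. Set $p^\alpha_\delta(S)=\sup\{\sum_j|I_j|^\alpha:\{I_j\}\text{ a }\delta\text{-packing with centers in }S\}$, $\tilde p^\alpha(S)=\lim_{\delta\to0}p^\alpha_\delta(S)=\inf_{\delta>0}p^\alpha_\delta(S)$, and $p^\alpha(S)=\inf\{\sum_{k=1}^\infty\tilde p^\alpha(S_k):S=\bigcup_{k=1}^\infty S_k\}$. For nonempty $S\subseteq\partial\mathbb{D}$, $\dim_{\mathrm P}(S)=\inf\{\alpha\ge 0:p^\alpha(S)=0\}$ (equivalently $\inf\{\alpha:p^\alpha(S)<\infty\}$). Upper packing dimension of a finite Borel measure $\mu$ on $\partial\mathbb{D}$: $\dim_{\mathrm P}^+(\mu)=\inf\{\dim_{\mathrm P}(S):S\subset\partial\mathbb{D}\text{ measurable},\ \mu(S)=\mu(\partial\mathbb{D})\}$. *)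

(* Defs.v *)
From HB Require Import structures.
From mathcomp Require Import all_boot all_order all_algebra sesquilinear complex.
From mathcomp Require Import all_classical all_reals all_analysis.
Import Order.TTheory GRing.Theory Num.Def Num.Theory.
Import numFieldNormedType.Exports.

Set Implicit Arguments.
Unset Strict Implicit.
Unset Printing Implicit Defensive.

Local Open Scope classical_set_scope.
Local Open Scope ring_scope.
Local Open Scope complex_scope.

Section UnitCircle.
Variable R : realType.

(* Through [set_type] the circle carries the topology induced by [R[i]^o]. *)
Definition circle : Type := set_type [set z : R[i]^o | `|z| = 1].

Definition circle1 : circle := exist _ (1 : R[i]^o) (mem_set (normr1 _)).

HB.instance Definition _ := Topological.on circle.
HB.instance Definition _ := isPointed.Build circle circle1.

Definition expi (t : R) : R[i] := cos t +i* sin t.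

(* The closed arc with center [c] and (arc) length [l]. *)
Definition arc (c : circle) (l : R) : set circle :=
  [set z | exists2 t : R, `|t| <= l / 2 & \val z = \val c * expi t].

End UnitCircle.

Notation borel T := (g_sigma_algebraType (@open T)).

Section Packing.
Variable R : realType.
Implicit Types (S : set (circle R)) (a delta : R).

(* A countable collection of arcs is coded by the set of the pairs
   (center, length) of its members. *)
Definition packing S delta (I : set (circle R * R)) : Prop :=
  [/\ countable I,
      forall x, I x -> [/\ S x.1, 0 < x.2, x.2 <= 2 * pi & x.2 <= delta]
    & trivIset I (fun x => arc x.1 x.2)].

Local Open Scope ereal_scope.

Definition packing_pre_delta a delta S : \bar R :=
  ereal_sup [set \esum_(x in I) (x.2 `^ a)%:E | I in packing S delta].

Definition packing_pre a S : \bar R :=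
  ereal_inf [set packing_pre_delta a delta S | delta in [set e | (0 < e)%R]].

Definition packing_measure a S : \bar R :=
  ereal_inf [set \sum_(0 <= k <oo) packing_pre a (T k)
            | T in [set T : (set (circle R))^nat | S = \bigcup_k T k]].

Definition packing_dim S : \bar R :=
  ereal_inf [set a%:E | a in [set a | (0 <= a)%R /\ packing_measure a S = 0]].

Definition upper_packing_dim
    (mu : {finite_measure set (borel (circle R)) -> \bar R}) : \bar R :=
  ereal_inf [set packing_dim S
            | S in [set S : set (circle R) |
                    measurable (S : set (borel (circle R))) /\
                    mu S = mu setT]].

End Packing.

Section SpectralMeasure.
Variable R : realType.

Definition bounded_borel (f : circle R -> R[i]) : Prop :=
  measurable_fun setT (f : borel (circle R) -> borel R[i]^o) /\
  exists M : R, forall z, `|f z| <= M%:C.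

Definition cintegral (mu : {finite_measure set (borel (circle R)) -> \bar R})
    (f : circle R -> R[i]) : R[i] :=
  (\int[mu]_z complex.Re (f z)) +i* (\int[mu]_z complex.Im (f z)).

Variables (H : completeNormedModType R[i]) (dot : {dot H for conjC}).

(* [dot] is linear in its first argument, whereas the inner product of
   [<psi, f(U) psi> = \int f dmu] is linear in the second one. *)
Definition inner (x y : H) : R[i] := dot y x.

Definition unitary (U : {linear H -> H}) : Prop :=
  (forall x y, inner (U x) (U y) = inner x y) /\ (forall y, exists x, U x = y).

(* [F f] is f(U): the map f |-> f(U) is the unique *-homomorphism from the
   bounded Borel functions on the circle to the bounded operators that sends the
   identity function to U and bounded pointwise limits to strong limits. *)
Record borel_functional_calculus (U : H -> H)
    (F : (circle R -> R[i]) -> H -> H) : Prop := {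
  bfc_linear : forall f, bounded_borel f -> linear (F f);
  bfc_continuous : forall f, bounded_borel f -> continuous (F f);
  bfc_one : forall x, F (fun=> 1) x = x;
  bfc_id : forall x, F (fun z => \val z) x = U x;
  bfc_comb : forall a f g x, bounded_borel f -> bounded_borel g ->
    F (fun z => a * f z + g z) x = a *: F f x + F g x;
  bfc_mul : forall f g x, bounded_borel f -> bounded_borel g ->
    F (fun z => f z * g z) x = F f (F g x);
  bfc_adj : forall f x y, bounded_borel f ->
    inner x (F f y) = inner (F (fun z => conjC (f z)) x) y;
  bfc_cvg : forall (f_ : nat -> circle R -> R[i]) (f : circle R -> R[i]) (M : R),
    (forall n, bounded_borel (f_ n)) -> bounded_borel f ->
    (forall n z, `|f_ n z| <= M%:C) ->
    (forall z, (f_ n z : R[i]^o) @[n --> \oo] --> (f z : R[i]^o)) ->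
    forall x, F (f_ n) x @[n --> \oo] --> F f x
}.

Definition spectral_measure (U : H -> H) (psi : H)
    (mu : {finite_measure set (borel (circle R)) -> \bar R}) : Prop :=
  exists2 F, borel_functional_calculus U F &
    forall f, bounded_borel f -> inner psi (F f psi) = cintegral mu f.

End SpectralMeasure.

Section Dynamics.
Variables (R : realType) (H : completeNormedModType R[i]).
Variables (dot : {dot H for conjC}) (d : nat).
Implicit Types (A : set {ffun 'I_d -> int}) (phi : {ffun 'I_d -> int} -> H).

Definition positive_orthant : set {ffun 'I_d -> int} :=
  [set n | forall i, 0 < n i].

Definition norm1 (n : {ffun 'I_d -> int}) : nat := (\sum_i `|n i|)%N.

Definition lin_span A phi : set H :=
  [set x | exists (s : seq {ffun 'I_d -> int}) (c : {ffun 'I_d -> int} -> R[i]),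
     (forall n, n \in s -> A n) /\ x = \sum_(n <- s) c n *: phi n].

(* The family is [phi] restricted to [A]. *)
Definition orthonormal_basis A phi : Prop :=
  (forall m n, A m -> A n -> inner dot (phi m) (phi n) = (m == n)%:R) /\
  dense (lin_span A phi).

Definition evolution (U : H -> H) (psi : H) (k : nat) : H := iter k U psi.

Definition amplitude phi U psi (n : {ffun 'I_d -> int}) (k : nat) : R :=
  Normc.normc (inner dot (phi n) (evolution U psi k)) ^+ 2.

Local Open Scope ereal_scope.

Definition moment A phi U psi (p : R) (k : nat) : \bar R :=
  \esum_(n in A)
    ((((norm1 n)%:R `^ p + 1) * amplitude phi U psi n k)%R)%:E.

Definition averaged_moment A phi U psi (p : R) (K : nat) : \bar R :=
  (\sum_(0 <= k < K) moment A phi U psi p k) / (K%:R)%:E.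

(* The terms K = 0, 1 carry no meaning and do not affect the limsup. *)
Definition upper_transport_exponent A phi U psi (p : R) : \bar R :=
  limn_esup (fun K : nat =>
    lne (averaged_moment A phi U psi p K) / ((p * ln K%:R)%R)%:E).

End Dynamics.

Definition separable_space (T : topologicalType) : Prop :=
  exists2 S : set T, countable S & dense S.

(* Main.v *)
Require Import Defs.
From HB Require Import structures.
From mathcomp Require Import all_boot all_order all_algebra sesquilinear complex.
From mathcomp Require Import all_classical all_reals all_analysis.
From mathcomp Require Import measurable_realfun zify ring lra.
Import Order.TTheory GRing.Theory Num.Def Num.Theory.
Import numFieldNormedType.Exports.
Local Open Scope classical_set_scope.
Local Open Scope ring_scope.
Local Open Scope complex_scope.

(** Let [b] exceed the transport exponent and let [s > d * b].  At the scale
    [K = 2 ^ j] the circle is covered by [K] arcs of length comparable to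
    [1 / K]; an arc is bad when its measure is below [K ^ - s], and the bad set
    [B] of the scale is the union of the bad arcs.  The theorem follows from an
    upper bound on [mu B] that decays geometrically in [j].

    Such a bound controls the packing dimension.  By the Borel-Cantelli lemma
    almost every point avoids the bad sets of all large scales, and at such a
    point [z] the measure of [arc z l] is at least a multiple of [l ^ s] for all
    small [l].  Disjoint arcs have a bounded total measure, so a set of such
    points has packing dimension at most [s] ([upper_packing_dim_le]).

    The bound itself comes from the dynamics.  Let [x] be the image of [psi]
    under the spectral projection of [U] on [B], so that the inner product of
    [U^k x] with [U^k psi] and the square of the norm of [x] are both [mu B].
    - The vector [x] spreads out.  The norm of [\sum_(k < K) c k *: U^k x] is
      the L2 norm on [B] of the polynomial with coefficients [c].  A polynomial
      of degree less than [K] is controlled on the arcs by its partial sums at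
      the [K]-th roots of unity, and Parseval's identity for these roots gives
      a large sieve inequality: the suprema over the [K] arcs of its squared
      modulus add up to at most a multiple of [K * \sum_(k < K) |c k| ^ 2]
      ([trig_poly_sample], [sum_sample_bound]).  As bad arcs have measure below
      [K ^ - s], the squared norm is at most [C * K ^ (1 - s)] times the sum of
      the [|c k| ^ 2] ([sqnorm_bad_poly]).  By duality ([dual_bound]) the time
      average of the squared coefficient of [U^k x] at any one lattice site is
      at most [C * K ^ - s].
    - The vector [psi] does not travel far.  The mass of [U^k psi] at distance
      more than [N] from the origin is at most [N ^ - p] times its moment.
    Splitting the inner product of [U^k x] and [U^k psi] into the sites within
    distance [N] and the others gives, after averaging in time
    ([bad_mass_bound]), [(mu B) ^ 2 <= C * (N ^ d * K ^ - s + N ^ - p * K ^ (p * b))].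
    With [N] about [K ^ b'] and [b < b' < s / d] both terms are at most a
    multiple of a negative power of [K] ([power_balance]), that is, they decay
    geometrically in [j].  Finally [b] and [s / d] are taken arbitrarily close to
    the transport exponent. *)

Set Implicit Arguments.
Unset Strict Implicit.
Unset Printing Implicit Defensive.

(* The name [arc] also denotes the arcs of a cyclic sequence. *)
Local Notation arc := Defs.arc.

(** * The modulus of complex numbers and the points of the circle *)

Section ComplexModulus.
Variable R : realType.
Implicit Types (z w u : R[i]) (t : R).
Local Notation normc := (@Normc.normc R).

Lemma normc_ge0 z : 0 <= normc z.
Proof. by case: z => a b; exact: sqrtr_ge0. Qed.

Lemma sqr_normcE z : normc z ^+ 2 = complex.Re z ^+ 2 + complex.Im z ^+ 2.
Proof. by case: z => a b /=; rewrite sqr_sqrtr// addr_ge0// sqr_ge0. Qed.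

Lemma mulc_conj z : z * z^* = (normc z ^+ 2)%:C.
Proof. by rewrite -sqr_normc rmorphXn. Qed.

Lemma normc_conj z : normc z^* = normc z.
Proof. by case: z => a b /=; rewrite sqrrN. Qed.

Lemma normcX z n : normc (z ^+ n) = normc z ^+ n.
Proof.
elim: n => [|n IH]; first by rewrite !expr0 Normc.normc1.
by rewrite !exprS Normc.normcM IH.
Qed.

Lemma normc_sum n (F : nat -> R[i]) :
  normc (\sum_(i < n) F i) <= \sum_(i < n) normc (F i).
Proof.
elim: n => [|n IH]; first by rewrite !big_ord0 Normc.normc0.
rewrite !big_ord_recr/=; apply: le_trans (le_normcD _ _) _.
by rewrite lerD2r.
Qed.

(** Expand the nonnegative sum of the squares of [n * a i - s], where [s] is the
    sum of the [a i]. *)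
Lemma sqr_sum_le n (a : nat -> R) :
  (\sum_(i < n) a i) ^+ 2 <= n%:R * \sum_(i < n) a i ^+ 2.
Proof.
case: n => [|n]; first by rewrite !big_ord0 expr0n mul0r.
set s := \sum_(i < _) a i; set q := \sum_(i < _) a i ^+ 2.
have : 0 <= \sum_(i < n.+1) (n.+1%:R * a i - s) ^+ 2.
  by apply: sumr_ge0 => i _; exact: sqr_ge0.
have -> : \sum_(i < n.+1) (n.+1%:R * a i - s) ^+ 2 =
    n.+1%:R * (n.+1%:R * q - s ^+ 2).
  rewrite (eq_bigr (fun i : 'I__ => n.+1%:R ^+ 2 * a i ^+ 2 -
      2 * n.+1%:R * s * a i + s ^+ 2)); last by move=> i _; ring.
  rewrite big_split/= sumrB -!mulr_sumr -/s -/q sumr_const card_ord.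
  rewrite -[_ *+ n.+1]mulr_natl; ring.
by rewrite pmulr_rge0 ?ltr0n// subr_ge0.
Qed.

Lemma expiD s t : expi (s + t) = expi s * expi t.
Proof. by rewrite /expi cosD sinD [sin s * _ + _]addrC. Qed.

Lemma expi0 : expi 0 = 1 :> R[i].
Proof. by rewrite /expi cos0 sin0. Qed.

Lemma expiX t n : expi t ^+ n = expi (n%:R * t).
Proof.
elim: n => [|n IH]; first by rewrite mul0r expi0.
by rewrite exprS IH -expiD -[n.+1]add1n natrD mulrDl mul1r.
Qed.

Lemma normc_expi t : normc (expi t) = 1.
Proof. by rewrite /= cos2Dsin2 sqrtr1. Qed.

Lemma expi2pi : expi (2 * pi) = 1 :> R[i].
Proof. by rewrite /expi mulr_natl cos2pi sin2pi. Qed.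

Lemma sin_le_ge0 t : 0 <= t -> `|sin t| <= t.
Proof.
rewrite le_eqVlt => /orP[/eqP <-|t0]; first by rewrite sin0 normr0.
have sin_cont : {within `[0, t], continuous (@sin R)}.
  by apply: continuous_subspaceT; exact: continuous_sin.
have [c _] := MVT t0 (fun x _ => is_derive_sin x) sin_cont.
rewrite sin0 !subr0 => ->; rewrite normrM (gtr0_norm t0).
by rewrite ler_piMl ?cos_max// ltW.
Qed.

Lemma normc_expi_sub1 t : normc (expi t - 1) ^+ 2 <= t ^+ 2.
Proof.
rewrite sqr_normcE/= subr0.
have -> : t ^+ 2 = 4 * (`|t| / 2) ^+ 2.
  by rewrite -[t ^+ 2]real_normK ?num_real//; field.
have -> : (cos t - 1) ^+ 2 + sin t ^+ 2 = 4 * `|sin (`|t| / 2)| ^+ 2.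
  rewrite real_normK ?num_real// sin2cos2 -cos_norm.
  have {1 2}-> : `|t| = (`|t| / 2) *+ 2 by rewrite -mulr_natl; field.
  rewrite cos_mulr2n sin2cos2 -mulr_natl; ring.
have t2 : 0 <= `|t| / 2 by rewrite divr_ge0.
by rewrite ler_pM2l ?ltr0n// lerXn2r ?nnegrE// sin_le_ge0.
Qed.

Lemma expi_neq1 t : 0 < t < 2 * pi -> expi t != 1 :> R[i].
Proof.
move=> /andP[t0 t2]; apply/eqP => -[/eqP ct _]; move: ct.
have {1}-> : t = (t / 2) *+ 2 by rewrite -mulr_natl; field.
rewrite cos_mulr2n cos2sin2 => /eqP ct.
have : 0 < sin (t / 2).
  by apply: sin_gt0_pi; rewrite divr_gt0//= ltr_pdivrMr// mulrC.
have : sin (t / 2) ^+ 2 = 0 by move: ct; rewrite -mulr_natl; lra.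
by move/eqP; rewrite sqrf_eq0 => /eqP ->; rewrite ltxx.
Qed.

Lemma circle_expi z : normc z = 1 -> exists2 t, 0 <= t < 2 * pi & z = expi t.
Proof.
move=> z1; have : complex.Re z ^+ 2 + complex.Im z ^+ 2 = 1.
  by rewrite -sqr_normcE z1 expr1n.
case: z {z1} => a b /= ab.
have a1 : -1 <= a <= 1 by apply/andP; split; nra.
have sE : sin (acos a) = `|b|.
  by rewrite sin_acos// -(sqrtr_sqr b); congr Num.sqrt; lra.
have p0 := @pi_gt0 R.
have [b0|b0] := leP 0 b.
  exists (acos a); last by rewrite /expi acosK// sE ger0_norm.
  by rewrite acos_ge0//=; apply: le_lt_trans (acos_lepi a1) _; lra.
exists (2 * pi - acos a).
  apply/andP; split; first by have := acos_lepi a1; lra.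
  suff : acos a != 0 by have := acos_ge0 a1; rewrite le_eqVlt eq_sym; lra.
  apply/eqP => a0; move: sE; rewrite a0 sin0 => /esym/eqP.
  by rewrite normr_eq0 lt_eqF.
rewrite expiD expi2pi mul1r /expi cosN sinN acosK// sE.
by rewrite ltr0_norm// opprK.
Qed.

End ComplexModulus.

(** * Values of a polynomial at well-spaced points of the circle *)

Section Sampling.
Variable R : realType.
Implicit Types (c : nat -> R[i]) (z w u : R[i]) (t : R).
Local Notation normc := (@Normc.normc R).

Definition trig_poly c n z := \sum_(k < n) c k * z ^+ k.

Definition unity_root (K : nat) : R[i] := expi (2 * pi / K%:R).

(** Moving from [w] to a nearby point [w * u] produces the factors
    [u ^+ k.+1 - u ^+ k], of modulus [|u - 1|]: the oscillation of a polynomial of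
    degree less than [n] is paid for by its partial sums at [w]. *)
Lemma abel_summation c w u n :
  trig_poly c n (w * u) = u ^+ n * trig_poly c n w -
    \sum_(k < n) (u ^+ k.+1 - u ^+ k) * trig_poly c k.+1 w.
Proof.
rewrite /trig_poly; elim: n => [|n IH].
  by rewrite !big_ord0 mulr0 subr0.
rewrite !big_ord_recr/= IH exprMn !exprS; ring.
Qed.

Lemma trig_poly_near c w u n : normc u = 1 ->
  normc (trig_poly c n (w * u)) ^+ 2 <=
    2 * normc (trig_poly c n w) ^+ 2 +
    2 * normc (u - 1) ^+ 2 *
      (n%:R * \sum_(k < n) normc (trig_poly c k.+1 w) ^+ 2).
Proof.
move=> u1; rewrite abel_summation.
set S := \sum_(k < n) (_ * _); set x := normc (trig_poly c n w).
pose s := \sum_(k < n) normc (trig_poly c k.+1 w).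
have xS : normc (u ^+ n * trig_poly c n w - S) <= x + normc (u - 1) * s.
  apply: le_trans (le_normcD _ _) _; rewrite normcN.
  rewrite Normc.normcM normcX u1 expr1n mul1r lerD2l.
  pose a k := (u ^+ k.+1 - u ^+ k) * trig_poly c k.+1 w.
  apply: le_trans (normc_sum n a) _.
  rewrite mulr_sumr; apply: ler_sum => k _; rewrite /a.
  have -> : u ^+ k.+1 - u ^+ k = (u - 1) * u ^+ k by rewrite exprS; ring.
  by rewrite !Normc.normcM normcX u1 expr1n mulr1.
have := sqr_sum_le n (fun k => normc (trig_poly c k.+1 w)).
rewrite -/s => /(ler_wpM2l (sqr_ge0 (normc (u - 1)))) sle.
have s0 : 0 <= s by apply: sumr_ge0 => k _; exact: normc_ge0.
have := normc_ge0 (u ^+ n * trig_poly c n w - S).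
have := normc_ge0 (u - 1); have : 0 <= x := normc_ge0 _.
move: sle xS.
set a := normc (_ - S); set b := normc (u - 1); set q := n%:R * _.
move=> sle xS x0 b0 a0.
have : a ^+ 2 <= (x + b * s) ^+ 2.
  by rewrite lerXn2r ?nnegrE// addr_ge0// mulr_ge0.
have := sqr_ge0 (x - b * s).
rewrite -mulrA; move: sle; rewrite -exprMn; nra.
Qed.

Lemma sum_powers_root K (q : R[i]) : q ^+ K = 1 -> q != 1 ->
  \sum_(i < K) q ^+ i = 0.
Proof.
move=> qK q1; apply/eqP; rewrite -(mulrI_eq0 _ (mulfI (_ : q - 1 != 0))).
  by rewrite -subrX1 qK subrr.
by rewrite subr_eq0.
Qed.

Lemma unity_rootX K : (0 < K)%N -> unity_root K ^+ K = 1.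
Proof.
move=> K0; rewrite /unity_root expiX -expi2pi; congr expi.
by rewrite mulrC divfK// pnatr_eq0 -lt0n.
Qed.

Lemma unity_root_neq1 K m : (0 < m < K)%N -> unity_root K ^+ m != 1.
Proof.
move=> /andP[m0 mK]; rewrite /unity_root expiX; apply: expi_neq1.
have K0 : (0 : R) < K%:R by rewrite ltr0n (leq_ltn_trans _ mK).
have pi0 := @pi_gt0 R.
rewrite mulr_gt0 ?ltr0n ?divr_gt0 ?mulr_gt0//=.
by rewrite mulrA ltr_pdivrMr// mulrC ltr_pM2l ?mulr_gt0// ltr_nat.
Qed.

Lemma normc1_conj z : normc z = 1 -> z * z^* = 1.
Proof. by move=> z1; rewrite mulc_conj z1 expr1n. Qed.

(** For [k != l] the terms are the powers of a [K]-th root of unity other than 1. *)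
Lemma unity_root_ortho K k l : (k < K)%N -> (l < K)%N ->
  \sum_(i < K) (unity_root K ^+ i) ^+ k * ((unity_root K ^+ i) ^+ l)^* =
  (K * (k == l))%:R.
Proof.
move=> kK lK; set w := unity_root K.
have K0 : (0 < K)%N by rewrite (leq_ltn_trans _ kK).
have w1 m : w ^+ m * (w ^+ m)^* = 1.
  by apply: normc1_conj; rewrite normcX /w /unity_root normc_expi expr1n.
transitivity (\sum_(i < K) (w ^+ k * (w ^+ l)^*) ^+ i).
  apply: eq_bigr => i _; rewrite exprMn -rmorphXn.
  by rewrite !(exprAC _ i).
have [->|kl] := eqVneq k l.
  rewrite (eq_bigr (fun=> 1)); last by move=> i _; rewrite w1 expr1n.
  by rewrite sumr_const card_ord muln1.
rewrite muln0 sum_powers_root//.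
  rewrite exprMn -!rmorphXn -!exprM !(mulnC _ K) !exprM unity_rootX//.
  by rewrite !expr1n rmorph1 mulr1.
suff : w ^+ k != w ^+ l.
  apply: contra => /eqP e; apply/eqP.
  by rewrite -[RHS]mul1r -e -mulrA [_^* * _]mulrC w1 mulr1.
wlog kl' : k l kK lK kl / (k < l)%N.
  move=> H; move: (kl); rewrite neq_ltn => /orP[|lt]; first exact: H.
  by rewrite eq_sym; apply: H => //; rewrite eq_sym.
apply/eqP => e; have lkK : (0 < l - k < K)%N.
  by rewrite subn_gt0 kl'/= (leq_ltn_trans (leq_subr _ _)).
apply/negP: (unity_root_neq1 lkK); rewrite negbK.
apply/eqP; apply: (@mulfI _ (w ^+ k)).
  apply/eqP => w0; have := w1 k; rewrite w0 mul0r => /esym/eqP.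
  by rewrite oner_eq0.
by rewrite -exprD subnKC 1?ltnW// -e mulr1.
Qed.

Lemma parseval_roots c K n : (n <= K)%N ->
  \sum_(i < K) normc (trig_poly c n (unity_root K ^+ i)) ^+ 2 =
  K%:R * \sum_(k < n) normc (c k) ^+ 2.
Proof.
move=> nK; apply: (@complexI R); rewrite rmorph_sum rmorphM rmorph_sum/=.
set w := unity_root K.
under eq_bigr do rewrite -mulc_conj.
transitivity (\sum_(k < n) \sum_(l < n) \sum_(i < K)
    (c k * (c l)^*) * ((w ^+ i) ^+ k * ((w ^+ i) ^+ l)^*)).
  transitivity (\sum_(i < K) \sum_(k < n) \sum_(l < n)
    (c k * (c l)^*) * ((w ^+ i) ^+ k * ((w ^+ i) ^+ l)^*)).
    apply: eq_bigr => i _; rewrite /trig_poly rmorph_sum mulr_suml.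
    apply: eq_bigr => k _; rewrite mulr_sumr; apply: eq_bigr => l _.
    by rewrite rmorphM; ring.
  rewrite exchange_big; apply: eq_bigr => k _; exact: exchange_big.
rewrite rmorph_nat mulr_sumr; apply: eq_bigr => k _.
under eq_bigr do rewrite -mulr_sumr unity_root_ortho ?(leq_trans (ltn_ord _) nK)//.
rewrite (bigD1 k)//= eqxx muln1 big1 ?addr0; last first.
  by move=> l; rewrite -val_eqE eq_sym => /negbTE ->; rewrite muln0 mulr0.
by rewrite mulc_conj mulrC.
Qed.

(** The right-hand side of [trig_poly_near] at a grid point, with [|u - 1|]
    replaced by the angular radius of the grid arcs. *)
Definition sample_bound c K (i : nat) : R :=
  2 * normc (trig_poly c K (unity_root K ^+ i)) ^+ 2 +
  2 * (2 * pi / K%:R) ^+ 2 * (K%:R *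
    \sum_(k < K) normc (trig_poly c k.+1 (unity_root K ^+ i)) ^+ 2).

Lemma trig_poly_sample c K i t : `|t| <= 2 * pi / K%:R ->
  normc (trig_poly c K (unity_root K ^+ i * expi t)) ^+ 2 <= sample_bound c K i.
Proof.
move=> tK; apply: le_trans (trig_poly_near _ _ _ (normc_expi _)) _.
rewrite lerD2l ler_wpM2r//.
  by rewrite mulr_ge0// sumr_ge0// => k _; exact: sqr_ge0.
rewrite ler_pM2l ?ltr0n//; apply: le_trans (normc_expi_sub1 _) _.
rewrite -[t ^+ 2]real_normK ?num_real// lerXn2r ?nnegrE//.
exact: le_trans tK.
Qed.

(** A large sieve inequality.  Parseval over the roots of unity bounds the
    contribution of each partial sum by [K] times the squared norm of [c], and the
    weight [(2 * pi / K) ^+ 2 * K] in [sample_bound] compensates the [K] partial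
    sums. *)
Lemma sum_sample_bound c K : (0 < K)%N ->
  \sum_(i < K) sample_bound c K i <=
  (2 + 8 * pi ^+ 2) * K%:R * \sum_(k < K) normc (c k) ^+ 2.
Proof.
move=> K0; rewrite big_split/= -!mulr_sumr exchange_big/= parseval_roots//.
set C := \sum_(k < K) normc (c k) ^+ 2.
have C0 : 0 <= C by apply: sumr_ge0 => k _; exact: sqr_ge0.
have K0' : (0 : R) < K%:R by rewrite ltr0n.
have le_sum : \sum_(k < K) \sum_(i < K)
    normc (trig_poly c k.+1 (unity_root K ^+ i)) ^+ 2 <= K%:R * (K%:R * C).
  have -> : K%:R * (K%:R * C) = \sum_(k < K) (K%:R * C).
    by rewrite sumr_const card_ord mulr_natl.
  apply: ler_sum => k _; rewrite parseval_roots// ler_pM2l//.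
  rewrite /C (big_ord_widen K (fun k => normc (c k) ^+ 2) (ltn_ord k)).
  rewrite [leRHS](bigID (fun j : 'I_K => (j < k.+1)%N))/= lerDl.
  by apply: sumr_ge0 => j _; exact: sqr_ge0.
have : 2 * (2 * pi / K%:R) ^+ 2 * (K%:R * (K%:R * (K%:R * C))) =
    8 * pi ^+ 2 * K%:R * C :> R.
  by field; rewrite gt_eqF.
have := ler_wpM2l _ (ler_wpM2l (ltW K0') le_sum).
move=> /(_ (2 * (2 * pi / K%:R) ^+ 2)) H.
have := H (mulr_ge0 (ler0n _ _) (sqr_ge0 _)).
lra.
Qed.

End Sampling.

(** * Arcs and packing dimension *)

Section Circle.
Variable R : realType.
Local Notation normc := (@Normc.normc R).
Implicit Types (c z : circle R) (t l : R).

Lemma circle_normc z : normc (\val z) = 1.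
Proof. by have := set_valP z; rewrite /= => /(congr1 (@complex.Re R)). Qed.

Lemma expi_circle_subproof t : (`|expi t : R[i]^o| = 1 :> R[i]).
Proof. by rewrite -[LHS]/((normc (expi t))%:C) normc_expi. Qed.

Definition expi_circle t : circle R :=
  exist _ (expi t : R[i]^o) (mem_set (expi_circle_subproof t)).

Lemma continuous_circle_val : continuous (\val : circle R -> R[i]^o).
Proof. exact: initial_continuous. Qed.

Lemma measurable_open_circle (A : set (circle R)) :
  open A -> measurable (A : set (borel (circle R))).
Proof. by move=> oA; exact: sub_sigma_algebra. Qed.

Lemma measurable_closed_circle (A : set (circle R)) :
  closed A -> measurable (A : set (borel (circle R))).
Proof.
move=> cA; rewrite -(setCK A); apply: measurableC.
by apply: measurable_open_circle; exact: closed_openC.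
Qed.

Lemma gt0_complexR (e : R[i]) : 0 < e -> e = (complex.Re e)%:C /\ 0 < complex.Re e.
Proof. by case: e => a b; rewrite ltcE/= => /andP[/eqP -> ->]. Qed.

(** The map is 1-Lipschitz. *)
Lemma continuous_mul_expi (a : R[i]) : normc a = 1 ->
  continuous (fun t : R => (a * expi t : R[i]^o)).
Proof.
move=> a1 t; apply/cvgrPdist_lt => e /gt0_complexR[-> e0].
near=> s.
rewrite -[ltLHS]/((normc (a * expi t - a * expi s))%:C) ltcR.
have -> : a * expi t - a * expi s = - (a * expi t * (expi (s - t) - 1)).
  have -> : expi s = expi (s - t) * expi t by rewrite -expiD subrK.
  ring.
rewrite normcN !Normc.normcM a1 normc_expi !mul1r.
apply: (@le_lt_trans _ _ `|t - s|); last first.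
  near: s; have := @cvg_id _ (nbhs t); move/cvgrPdist_lt.
  by apply; rewrite ?e0.
rewrite -ler_sqr ?nnegrE ?normc_ge0//.
by rewrite real_normK ?num_real// -[leRHS]sqrrN opprB normc_expi_sub1.
Unshelve. all: by end_near. Qed.

(** An arc is the trace on the circle of a compact set, the continuous image of a
    segment. *)
Lemma closed_arc c l : closed (arc c l).
Proof.
pose g t := (\val c * expi t : R[i]^o).
have -> : arc c l = \val @^-1` (g @` `[- (l / 2), l / 2]%classic).
  apply/seteqP; split => z /=.
    by move=> [t tl zE]; exists t; rewrite // in_itv/= -ler_norml.
  by move=> [t]; rewrite in_itv/= -ler_norml => tl zE; exists t.
apply: closed_comp; first by move=> z _; exact: continuous_circle_val.
apply: compact_closed; first exact: norm_hausdorff.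
apply: continuous_compact; last exact: segment_compact.
apply: continuous_subspaceT; apply: continuous_mul_expi.
exact: circle_normc.
Qed.

Lemma measurable_arc c l : measurable (arc c l : set (borel (circle R))).
Proof. apply: measurable_closed_circle; exact: closed_arc. Qed.

(** The half-length is a full step of the grid, twice what a covering requires, so
    that rounding down suffices to find an arc around a given point. *)
Definition grid_arc (K i : nat) : set (circle R) :=
  arc (expi_circle (i%:R * (2 * pi / K%:R))) (2 * (2 * pi / K%:R)).

Lemma grid_arcP K i z : grid_arc K i z ->
  exists2 t, `|t| <= 2 * pi / K%:R & \val z = unity_root R K ^+ i * expi t.
Proof.
move=> [t tK zE]; exists t.
  by apply: le_trans tK _; rewrite mulrC mulKf ?pnatr_eq0.
by rewrite zE/= /unity_root expiX.
Qed.

Lemma grid_arc_cover K z : (0 < K)%N -> exists2 i, (i < K)%N & grid_arc K i z.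
Proof.
move=> K0; have [t /andP[t0 t2] zE] := circle_expi (circle_normc z).
have K0' : (0 : R) < K%:R by rewrite ltr0n.
have pi0 := @pi_gt0 R.
pose h : R := 2 * pi / K%:R; have h0 : 0 < h by rewrite divr_gt0 ?mulr_gt0.
have th : 0 <= t / h by rewrite divr_ge0// ltW.
have /andP[] := truncn_itv th; set i := truncn _ => il iu.
exists i.
  rewrite -(ltr_nat R); apply: le_lt_trans il _.
  by rewrite ltr_pdivrMr// /h mulrC divfK// gt_eqF.
move: il iu; rewrite ler_pdivlMr// ltr_pdivrMr// => il iu.
exists (t - i%:R * h); last by rewrite /= -expiD addrC subrK.
rewrite -/h [2 * h]mulrC mulfK ?pnatr_eq0// ger0_norm ?subr_ge0//.
by move: iu; rewrite -natr1 mulrDl mul1r lerBlDl => /ltW.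
Qed.

Lemma grid_arc_sub K i z l : grid_arc K i z -> 8 * pi / K%:R <= l ->
  grid_arc K i `<=` arc z l.
Proof.
move=> /grid_arcP[t tK zE] lK y /grid_arcP[s sK yE]; exists (s - t); last first.
  by rewrite yE zE -mulrA -expiD addrC subrK.
apply: le_trans (ler_normB _ _) _; move: tK sK lK.
rewrite -!mulrA; set q := pi / K%:R; lra.
Qed.

End Circle.

Section PackingDim.
Variable R : realType.
Variable mu : {finite_measure set (borel (circle R)) -> \bar R}.
Implicit Types (S : set (circle R)).
Local Open Scope ereal_scope.

Lemma packing_pre_ge0 (a : R) S : 0 <= packing_pre a S.
Proof.
apply: le_ereal_inf_tmp => _ [delta _ <-]; apply: ereal_sup_ubound.
exists set0; last by rewrite esum_set0.
by split => //; move=> x y [].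
Qed.

Lemma sum_arc_le (X : set (circle R * R)) : finite_set X ->
  trivIset X (fun x => arc x.1 x.2) ->
  \sum_(x \in X) mu (arc x.1 x.2) <= mu setT.
Proof.
move=> finX trivX.
rewrite -(measure_fin_bigcup mu finX trivX); last first.
  by move=> x _; exact: measurable_arc.
rewrite le_measure ?inE//.
by apply: fin_bigcup_measurable => // x _; exact: measurable_arc.
Qed.

(** In a packing by arcs of length at most [dl], each term [l ^ a] is at most
    [dl ^ (a - s) * C] times the measure of the arc; the arcs being disjoint, the
    sum is at most [dl ^ (a - s) * C * mu setT], which tends to 0 with [dl]. *)
Lemma packing_pre_eq0 S (s a C d0 : R) : (0 < C)%R -> (0 < d0)%R -> (s < a)%R ->
  (forall z l, S z -> (0 < l <= d0)%R ->
    (l `^ s)%:E <= C%:E * mu (arc z l)) ->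
  packing_pre a S = 0.
Proof.
move=> C0 d00 sa Sle; apply/eqP; rewrite eq_le packing_pre_ge0 andbT.
apply/lee_addgt0Pr => e e0; rewrite add0e.
(* The added 1 makes [m] positive even for the null measure. *)
pose m := (fine (mu setT) + 1)%R.
have mE : mu setT = (fine (mu setT))%:E by rewrite fineK// fin_num_measure.
have m0 : (0 < m)%R by rewrite ltr_wpDl// fine_ge0.
(* The length at which [dl ^ (a - s) * (C * m)] falls below [e]. *)
pose dl := Num.min d0 ((e / (C * m)) `^ (a - s)^-1)%R.
have dl0 : (0 < dl)%R by rewrite lt_min d00 powR_gt0// divr_gt0// mulr_gt0.
apply: (@le_trans _ _ (packing_pre_delta a dl S)).
  by apply: ereal_inf_lbound; exists dl.
apply: ge_ereal_sup => _ [I [_ Ile trivI] <-].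
apply: ge_ereal_sup => _ [X [finX XI] <-].
have dla : (dl `^ (a - s) * (C * m) <= e)%R.
  rewrite -ler_pdivlMr ?mulr_gt0//.
  apply: (@le_trans _ _ (((e / (C * m)) `^ (a - s)^-1) `^ (a - s))%R).
    rewrite ge0_ler_powR ?nnegrE ?subr_ge0 ?(ltW sa) ?(ltW dl0) ?powR_ge0//.
    by rewrite ge_min lexx orbT.
  rewrite -powRrM mulVf ?subr_eq0 ?gt_eqF// powRr1// divr_ge0// ltW//.
  by rewrite mulr_gt0.
apply: (@le_trans _ _ (\sum_(x \in X) ((dl `^ (a - s) * C)%:E * mu (arc x.1 x.2)))).
  apply: lee_fsum => // x /XI Ix; have [Sx x0 _ xdl] := Ile _ Ix.
  have -> : (x.2 `^ a = x.2 `^ (a - s) * x.2 `^ s)%R.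
    by rewrite -powRD ?subrK// (gt_eqF x0) implybT.
  rewrite EFinM EFinM -muleA; apply: lee_pmul; rewrite ?lee_fin ?powR_ge0//.
    by rewrite ge0_ler_powR ?nnegrE ?subr_ge0 ?(ltW sa) ?(ltW dl0) ?(ltW x0).
  by apply: Sle => //; rewrite x0 (le_trans xdl)// ge_min lexx.
rewrite -ge0_mule_fsumr//.
apply: (@le_trans _ _ ((dl `^ (a - s) * C)%:E * m%:E)).
  apply: lee_pmul => //.
  - by rewrite lee_fin mulr_ge0 ?powR_ge0// ltW.
  - by apply: fsume_ge0.
  - apply: (@le_trans _ _ (mu setT)).
      by apply: sum_arc_le => //; exact: sub_trivIset trivI.
    by rewrite mE lee_fin lerDl.
by rewrite -EFinM lee_fin -mulrA.
Qed.

Lemma packing_dim_le (T : (set (circle R))^nat) (s : R) : (0 <= s)%R ->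
  (forall n, exists C d0 : R, [/\ (0 < C)%R, (0 < d0)%R &
    forall z l, T n z -> (0 < l <= d0)%R ->
      (l `^ s)%:E <= C%:E * mu (arc z l)]) ->
  packing_dim (\bigcup_n T n) <= s%:E.
Proof.
move=> s0 TP; apply/lee_addgt0Pr => e e0; rewrite -EFinD.
apply: ereal_inf_lbound; exists (s + e)%R => //; split.
  by rewrite addr_ge0// ltW.
apply/eqP; rewrite eq_le; apply/andP; split.
  apply: ereal_inf_lbound; exists T => //.
  apply: eseries0 => n _ _; have [C [d0 [C0 d00 H]]] := TP n.
  by apply: (packing_pre_eq0 C0 d00 _ H); rewrite ltrDl.
apply: le_ereal_inf_tmp => _ [V _ <-].
by apply: nneseries_ge0 => n _ _; exact: packing_pre_ge0.
Qed.

(** The arcs of scale [K] where [mu] looks as if its local dimension exceeded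
    [s]. *)
Definition bad_set (s : R) (K : nat) : set (circle R) :=
  \bigcup_(i in [set i | (i < K)%N /\ mu (grid_arc K i) < (K%:R `^ - s)%:E])
    grid_arc K i.

Lemma measurable_bad_set s K :
  measurable (bad_set s K : set (borel (circle R))).
Proof. by apply: bigcup_measurable => i _; exact: measurable_arc. Qed.

Lemma dyadic_scale (n : nat) (b l : R) : (0 < l)%R -> (0 < b)%R ->
  (l <= b / 2 ^+ n)%R ->
  exists2 j, (n <= j)%N & (b / 2 ^+ j <= l <= 2 * (b / 2 ^+ j))%R.
Proof.
move=> l0 b0 ln.
have ex : exists j, (n <= j)%N && (b / 2 ^+ j <= l)%R.
  exists (maxn n (archi_bound (b / l))); rewrite leq_maxl/=.
  rewrite ler_pdivrMr ?exprn_gt0// mulrC -ler_pdivrMr//.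
  by apply/ltW/upper_nthrootP; exact: leq_maxr.
(* Minimality of [j] gives the upper bound on [l], unless [j] is already [n]. *)
case: (ex_minnP ex) => j /andP[nj jl] jmin; exists j => //; rewrite jl/=.
move: nj; rewrite leq_eqVlt => /orP[/eqP <-|nj].
  by apply: le_trans ln _; rewrite ler_peMl ?ler1n// divr_ge0 ?exprn_ge0// ltW.
case: j => // j in jl jmin nj *.
rewrite leNgt; apply/negP => lt_l.
suff /jmin : (n <= j)%N && (b / 2 ^+ j <= l)%R by rewrite ltnn.
rewrite -ltnS nj/=; apply: le_trans (ltW lt_l).
by rewrite exprS invfM mulrCA mulVKf.
Qed.

(** At the dyadic scale comparable to [l], a grid arc containing [z] is contained in
    [arc z l] and is not bad; [l] is then at most [16 * pi / 2 ^ j]. *)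
Lemma good_set_scaling (s : R) n z l : (0 <= s)%R ->
  (forall j, (n <= j)%N -> ~ bad_set s (2 ^ j) z) ->
  (0 < l <= 8 * pi / 2 ^+ n)%R ->
  (l `^ s)%:E <= ((16 * pi) `^ s)%:E * mu (arc z l).
Proof.
move=> s0 zgood /andP[l0 ln]; have pi0 := @pi_gt0 R.
have b0 : (0 < 8 * pi :> R)%R by rewrite mulr_gt0.
have [j nj /andP[jl lj]] := dyadic_scale l0 b0 ln.
have K0 : (0 < 2 ^ j)%N by rewrite expn_gt0.
have [i iK zi] := grid_arc_cover z K0.
have mui : ((2 ^ j)%:R `^ - s)%:E <= mu (grid_arc (2 ^ j) i).
  by rewrite leNgt; apply/negP => lt; apply: (zgood j nj); exists i.
have mule : mu (grid_arc (2 ^ j) i) <= mu (arc z l).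
  rewrite le_measure ?inE//; [exact: measurable_arc|exact: measurable_arc|].
  by apply: (grid_arc_sub zi); rewrite natrX.
apply: (@le_trans _ _ (((16 * pi) `^ s)%:E * ((2 ^ j)%:R `^ - s)%:E)).
  rewrite -EFinM lee_fin powRN natrX.
  have -> : (((2 ^+ j) `^ s)^-1 = ((2 ^+ j)^-1) `^ s :> R)%R.
    by rewrite -[((_ ^+ j)^-1)%R]powR_inv1 ?exprn_ge0// -powRrM mulN1r powRN.
  rewrite -powRM ?mulr_ge0 ?invr_ge0 ?exprn_ge0 ?(ltW pi0)//.
  rewrite ge0_ler_powR ?nnegrE ?(ltW l0)//.
    by rewrite !mulr_ge0 ?invr_ge0 ?exprn_ge0 ?(ltW pi0).
  by apply: le_trans lj _; rewrite !mulrA -natrM.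
by rewrite lee_pmul2l// ?lte_fin ?powR_gt0 ?mulr_gt0//; exact: le_trans mule.
Qed.

(** By the Borel-Cantelli lemma the points lying in finitely many bad sets have
    full measure; sort them by the scale from which on they avoid the bad sets. *)
Lemma upper_packing_dim_le (s : R) : (0 <= s)%R ->
  \sum_(0 <= j <oo) mu (bad_set s (2 ^ j)) < +oo ->
  upper_packing_dim mu <= s%:E.
Proof.
move=> s0 sum_bad.
pose B j : set (borel (circle R)) := bad_set s (2 ^ j).
have mB j : measurable (B j) by exact: measurable_bad_set.
have mlim : measurable (lim_sup_set B).
  by apply: bigcapT_measurable => n; apply: bigcup_measurable.
have mu0 : mu (lim_sup_set B) = 0 by apply: lim_sup_set_cvg0.
pose T n : set (circle R) := [set z | forall j, (n <= j)%N -> ~ B j z].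
have TE : \bigcup_n T n = ~` lim_sup_set B.
  rewrite setC_bigcap; apply: eq_bigcupr => n _.
  rewrite setC_bigcup; apply/seteqP; split => z zT j nj.
    by have := zT j nj.
  by have := zT j nj.
apply: (@le_trans _ _ (packing_dim (\bigcup_n T n))).
  apply: ereal_inf_lbound; exists (\bigcup_n T n) => //; split.
    by rewrite TE; exact: measurableC.
  have -> : [set: borel (circle R)] = ~` lim_sup_set B `|` lim_sup_set B.
    by rewrite setvU.
  rewrite TE measureU//; [|exact: measurableC|exact: setICl].
  by rewrite [X in _ = (_ + X)%E]mu0 adde0.
apply: packing_dim_le => // n.
exists ((16 * pi) `^ s)%R, (8 * pi / 2 ^+ n)%R; have pi0 := @pi_gt0 R.
split; rewrite ?powR_gt0 ?divr_gt0 ?mulr_gt0//.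
by move=> z l zT; exact: good_set_scaling.
Qed.

End PackingDim.

(** * Hilbert space geometry *)

Section InnerProduct.
Variables (R : realType) (H : completeNormedModType R[i]).
Variable dot : {dot H for conjC}.
Local Notation normc := (@Normc.normc R).
Local Notation "<[ x | y ]>" := (inner dot x y) (at level 8).
Implicit Types (x y z : H) (a : R[i]).

Lemma innerDr x y z : <[x | y + z]> = <[x | y]> + <[x | z]>.
Proof. exact: linearDl. Qed.
Lemma innerDl x y z : <[x + y | z]> = <[x | z]> + <[y | z]>.
Proof. exact: linearDr. Qed.
Lemma innerBr x y z : <[x | y - z]> = <[x | y]> - <[x | z]>.
Proof. exact: linearBl. Qed.
Lemma innerZr x a y : <[x | a *: y]> = a * <[x | y]>.
Proof. exact: linearZl_LR. Qed.
Lemma innerZl x a y : <[a *: x | y]> = a^* * <[x | y]>.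
Proof. exact: linearZr_LR. Qed.
Lemma inner0r x : <[x | 0]> = 0. Proof. exact: linear0l. Qed.
Lemma innerC x y : <[x | y]> = <[y | x]>^*.
Proof. by rewrite /inner hermC mul1r. Qed.
Lemma inner_sumr x I (r : seq I) (F : I -> H) :
  <[x | \sum_(i <- r) F i]> = \sum_(i <- r) <[x | F i]>.
Proof. exact: linear_sumlz. Qed.
Lemma inner_suml x I (r : seq I) (F : I -> H) :
  <[\sum_(i <- r) F i | x]> = \sum_(i <- r) <[F i | x]>.
Proof. exact: linear_sumr. Qed.

Definition sqnorm x : R := complex.Re <[x | x]>.

Lemma sqnormE x : <[x | x]> = (sqnorm x)%:C.
Proof.
rewrite /sqnorm RRe_real// ger0_real//; exact: dnorm_ge0.
Qed.

Lemma sqnorm_ge0 x : 0 <= sqnorm x.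
Proof. by rewrite -ler0c -sqnormE; exact: dnorm_ge0. Qed.

Lemma sqnorm_eq0 x : sqnorm x = 0 -> x = 0.
Proof.
by move=> x0; apply/eqP; rewrite -(dnorm_eq0 dot) -[dot x x]/<[x | x]> sqnormE x0.
Qed.

Lemma sqnormD_ortho x y : <[x | y]> = 0 -> sqnorm (x + y) = sqnorm x + sqnorm y.
Proof.
move=> xy; rewrite /sqnorm innerDr !innerDl xy (innerC y x) xy rmorph0 addr0 add0r.
by rewrite [in RHS]sqnormE [in RHS](sqnormE y) sqnormE (sqnormE y) -rmorphD.
Qed.

Lemma cauchy_schwarz x y : normc <[x | y]> ^+ 2 <= sqnorm x * sqnorm y.
Proof.
have [y0|yN0] := eqVneq (sqnorm y) 0.
  by rewrite (sqnorm_eq0 y0) inner0r Normc.normc0 expr0n/= mulr_ge0// sqnorm_ge0.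
have y0 : 0 < sqnorm y by rewrite lt_def yN0 sqnorm_ge0.
have yC : (sqnorm y)%:C != 0 by rewrite (inj_eq (@complexI _)).
(* [p] is the orthogonal projection of [x] on the line of [y]. *)
pose p := (<[y | x]> / (sqnorm y)%:C) *: y.
have xpy : <[p | x - p]> = 0.
  by rewrite innerBr !innerZl innerZr sqnormE divfK// subrr.
have : sqnorm x = sqnorm p + sqnorm (x - p).
  by rewrite -sqnormD_ortho// addrC subrK.
have -> : sqnorm p = normc <[x | y]> ^+ 2 / sqnorm y.
  apply: complexI; rewrite -sqnormE /p innerZl innerZr sqnormE.
  rewrite mulrA [_^* * _]mulrC mulc_conj Normc.normcM Normc.normcV.
  rewrite (innerC x y) normc_conj.
  have -> : normc (sqnorm y)%:C = sqnorm y.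
    by rewrite /= expr0n addr0 sqrtr_sqr gtr0_norm.
  by rewrite -rmorphM; congr _%:C; field.
by move=> ->; rewrite mulrDl divfK// lerDl mulr_ge0// sqnorm_ge0.
Qed.

Section Orthonormal.
Variables (T : choiceType) (phi : T -> H).

Definition proj (s : seq T) x := \sum_(n <- s) <[phi n | x]> *: phi n.

Definition coef_mass (s : seq T) x : R :=
  \sum_(n <- s) normc <[phi n | x]> ^+ 2.

Definition orthonormal_seq (s : seq T) : Prop :=
  uniq s /\ {in s &, forall m n, <[phi m | phi n]> = (m == n)%:R}.

Variable s : seq T.
Hypothesis ON : orthonormal_seq s.

Lemma coef_mass_ge0 x : 0 <= coef_mass s x.
Proof. by apply: sumr_ge0 => n _; exact: sqr_ge0. Qed.

Lemma inner_proj x y :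
  <[proj s x | y]> = \sum_(n <- s) <[phi n | x]>^* * <[phi n | y]>.
Proof. by rewrite inner_suml; apply: eq_bigr => n _; rewrite innerZl. Qed.

Lemma coef_proj n x : n \in s -> <[phi n | proj s x]> = <[phi n | x]>.
Proof.
move=> ns; rewrite inner_sumr (bigD1_seq n)//=; last by case: ON.
rewrite innerZr (ON.2 _ _ ns ns) eqxx mulr1 big_seq_cond big1 ?addr0// => m.
by move=> /andP[ms mn]; rewrite innerZr (ON.2 _ _ ns ms) eq_sym (negbTE mn) mulr0.
Qed.

Lemma proj_orthol x y : <[proj s x | y - proj s y]> = 0.
Proof.
rewrite inner_proj big_seq big1// => n ns.
by rewrite innerBr coef_proj// subrr mulr0.
Qed.

Lemma sqnorm_proj x : sqnorm (proj s x) = coef_mass s x.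
Proof.
apply: complexI; rewrite -sqnormE inner_proj rmorph_sum/= big_seq [RHS]big_seq.
apply: eq_bigr => n ns; by rewrite coef_proj// mulrC mulc_conj.
Qed.

Lemma sqnorm_residual x : sqnorm (x - proj s x) = sqnorm x - coef_mass s x.
Proof.
have -> : sqnorm x = sqnorm (proj s x) + sqnorm (x - proj s x).
  by rewrite -sqnormD_ortho ?proj_orthol// addrC subrK.
by rewrite sqnorm_proj addrAC subrr add0r.
Qed.

Lemma proj_id n : n \in s -> proj s (phi n) = phi n.
Proof.
move=> ns; rewrite /proj (bigD1_seq n)//=; last by case: ON.
rewrite (ON.2 _ _ ns ns) eqxx scale1r big_seq_cond big1 ?addr0// => m.
by move=> /andP[ms mn]; rewrite (ON.2 _ _ ms ns) (negbTE mn) scale0r.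
Qed.

Lemma projB x y : proj s (x - y) = proj s x - proj s y.
Proof.
by rewrite /proj -sumrB; apply: eq_bigr => n _; rewrite innerBr scalerBl.
Qed.

Lemma proj_span (t : seq T) (c : T -> R[i]) : {subset t <= s} ->
  proj s (\sum_(n <- t) c n *: phi n) = \sum_(n <- t) c n *: phi n.
Proof.
move=> ts; rewrite /proj.
under eq_bigr do rewrite inner_sumr scaler_suml.
rewrite exchange_big/= big_seq [RHS]big_seq; apply: eq_bigr => n nt.
rewrite -[in RHS](proj_id (ts _ nt)) /proj scaler_sumr.
by apply: eq_bigr => m _; rewrite innerZr scalerA.
Qed.

(** The residual of [x] is also the residual of [x - v] for any [v] in the span,
    and projecting does not increase norms. *)
Lemma best_approximation (t : seq T) (c : T -> R[i]) x : {subset t <= s} ->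
  sqnorm (x - proj s x) <= sqnorm (x - \sum_(n <- t) c n *: phi n).
Proof.
move=> ts; set v := \sum_(n <- t) _.
have -> : x - proj s x = (x - v) - proj s (x - v).
  by rewrite projB /v proj_span// -/v opprB addrA subrK.
by rewrite sqnorm_residual lerBlDr lerDl coef_mass_ge0.
Qed.

(** The inner product splits into the components of [y] along the sites of [s] and
    the residual; Cauchy-Schwarz bounds each of the two. *)
Lemma inner_split_le x y :
  normc <[x | y]> ^+ 2 <=
  2 * (coef_mass s x * sqnorm y) + 2 * (sqnorm x * sqnorm (y - proj s y)).
Proof.
have -> : <[x | y]> = <[proj s x | y]> + <[x | y - proj s y]>.
  have e : <[proj s x | y]> = <[x | proj s y]>.
    rewrite inner_sumr inner_proj; apply: eq_bigr => n _.
    by rewrite innerZr (innerC x) mulrC.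
  by rewrite innerBr e addrC subrK.
have := cauchy_schwarz (proj s x) y; have := cauchy_schwarz x (y - proj s y).
rewrite sqnorm_proj; set a := <[_ | _]>; set b := <[_ | _]>.
have : normc (b + a) ^+ 2 <= (normc b + normc a) ^+ 2.
  by rewrite lerXn2r ?nnegrE ?normc_ge0 ?addr_ge0 ?normc_ge0//; exact: le_normcD.
have := sqr_ge0 (normc b - normc a); nra.
Qed.

End Orthonormal.

(** The map sending [c] to [\sum_k c k *: v k] and its adjoint, which sends [f]
    to its inner products with the [v k], have the same norm: test the hypothesis on
    the coefficients given by the adjoint. *)
Lemma dual_bound (K : nat) (v : nat -> H) (D : R) (f : H) : 0 <= D ->
  (forall c : nat -> R[i],
    sqnorm (\sum_(k < K) c k *: v k) <= D * \sum_(k < K) normc (c k) ^+ 2) ->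
  sqnorm f = 1 -> \sum_(k < K) normc <[f | v k]> ^+ 2 <= D.
Proof.
move=> D0 vD f1; set q := \sum_(k < K) _.
pose c k := <[f | v k]>^*.
have qE : \sum_(k < K) normc (c k) ^+ 2 = q.
  by apply: eq_bigr => k _; rewrite normc_conj.
have q0 : 0 <= q by apply: sumr_ge0 => k _; exact: sqr_ge0.
have := cauchy_schwarz f (\sum_(k < K) c k *: v k); rewrite f1 mul1r.
have -> : <[f | \sum_(k < K) c k *: v k]> = q%:C.
  rewrite inner_sumr rmorph_sum/=; apply: eq_bigr => k _.
  by rewrite innerZr mulrC mulc_conj.
rewrite /= expr0n addr0 sqr_sqrtr ?sqr_ge0// => qq.
have := le_trans qq (vD c); rewrite qE.
have [->//|qN0] := eqVneq q 0.
by rewrite expr2 ler_pM2r// lt_def qN0.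
Qed.

Hypothesis normE : forall x : H, `|x| ^+ 2 = <[x | x]>.

Lemma dense_sqnorm (S : set H) : dense S -> forall x (e : R), 0 < e ->
  exists2 v, S v & sqnorm (x - v) <= e.
Proof.
move=> dS x e e0; pose r := Num.sqrt e.
have r0 : 0 < r by rewrite sqrtr_gt0.
have rC : 0 < r%:C :> R[i] by rewrite ltcR.
have [||v [xv Sv]] := dS (ball x r%:C).
- by exists x; exact: ballxx.
- exact: ball_open.
exists v => //; move: xv; rewrite -ball_normE/= => xv.
rewrite -lecR -sqnormE -normE.
have -> : e%:C = r%:C ^+ 2 by rewrite -rmorphXn/= sqr_sqrtr// ltW.
by rewrite lerXn2r ?nnegrE// ltW.
Qed.

(** Enlarge [s] by the finitely many sites of a linear combination close to [y]: the
    new residual is arbitrarily small, so the residual for [s] is nearly the mass of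
    [y] on the added sites, where the weight is at least [W]. *)
Lemma residual_le_esum (T : choiceType) (phi : T -> H) (A : set T) (s : seq T)
    (w : T -> R) (W : R) y :
  (forall m n, A m -> A n -> <[phi m | phi n]> = (m == n)%:R) ->
  dense [set x | exists (t : seq T) (c : T -> R[i]),
     (forall n, n \in t -> A n) /\ x = \sum_(n <- t) c n *: phi n] ->
  uniq s -> (forall n, n \in s -> A n) ->
  0 < W -> (forall n, A n -> n \notin s -> W <= w n) ->
  ((W * sqnorm (y - proj phi s y))%:E <=
    \esum_(n in A) (w n * normc <[phi n | y]> ^+ 2)%:E)%E.
Proof.
move=> ON dA us sA W0 Ww; apply/lee_addgt0Pr => e e0.
have [_ [t [c [tA ->]]] ye] := dense_sqnorm dA y (divr_gt0 e0 W0).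
pose r := [seq n <- undup t | n \notin s].
have ur : uniq r by rewrite filter_uniq// undup_uniq.
have rA n : n \in r -> A n /\ n \notin s.
  by rewrite mem_filter mem_undup => /andP[ns /tA].
have ONu : orthonormal_seq phi (s ++ r).
  split.
    rewrite cat_uniq us ur andbT/= -all_predC; apply/allP => n.
    by rewrite mem_filter => /andP[].
  have uA n : n \in s ++ r -> A n by rewrite mem_cat => /orP[/sA//|/rA[]].
  by move=> m n /uA mA /uA nA; exact: ON.
have ONs : orthonormal_seq phi s.
  by split => // m n /sA mA /sA nA; exact: ON.
have tu : {subset t <= s ++ r}.
  by move=> n nt; rewrite mem_cat mem_filter mem_undup nt andbT orbN.
have := best_approximation ONu c y tu.
rewrite sqnorm_residual// => /le_trans/(_ ye).
rewrite sqnorm_residual// /coef_mass big_cat/= ler_pdivlMr// => le_e.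
apply: (@le_trans _ _ ((\sum_(n <- r) w n * normc <[phi n | y]> ^+ 2)%:E + e%:E)%E).
  rewrite -EFinD lee_fin.
  have : \sum_(n <- r) W * normc <[phi n | y]> ^+ 2 <=
      \sum_(n <- r) w n * normc <[phi n | y]> ^+ 2.
    rewrite big_seq [leRHS]big_seq; apply: ler_sum => n /rA[nA ns].
    by rewrite ler_wpM2r ?sqr_ge0// Ww.
  rewrite -mulr_sumr; move: le_e; lra.
rewrite leeD2r//; apply: esum_ge; exists [set` r].
  by split; [exact: finite_seq|move=> n /= /rA[]].
by rewrite -fsbig_seq// sumEFin.
Qed.

End InnerProduct.

(** * Cut-off functions on the circle *)

Section BoundedBorel.
Variable R : realType.
Local Notation normc := (@Normc.normc R).
Implicit Types (f h : circle R -> R[i]) (B : set (circle R)).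

(** The codomain is read as [R[i]^o], which carries the topology. *)
Definition circle_cont h : Prop := continuous (h : circle R -> R[i]^o).

Lemma circle_contP h : circle_cont h <->
  forall z (e : R), 0 < e -> \forall w \near z, normc (h z - h w) < e.
Proof.
split=> [hc z e e0|hc z].
  have /cvgrPdist_lt := hc z; move=> /(_ e%:C); rewrite ltcR => /(_ e0).
  by apply: filterS => w; rewrite -ltcR.
have nz : Filter (nbhs z) := nbhs_filter z.
apply/(@cvgrPdist_lt _ (R[i]^o) _ (nbhs z) nz) => e /gt0_complexR[-> e0].
by have := hc z _ e0; apply: filterS => w; rewrite -ltcR.
Qed.

Lemma circle_cont_val : circle_cont (\val : circle R -> R[i]).
Proof. exact: continuous_circle_val. Qed.

Lemma circle_cont_cst (a : R[i]) : circle_cont (fun=> a).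
Proof.
apply/circle_contP => z e e0.
by apply: (@filterE _ (nbhs z) (nbhs_filter z)) => w; rewrite subrr Normc.normc0.
Qed.

Lemma circle_contD f h :
  circle_cont f -> circle_cont h -> circle_cont (fun z => f z + h z).
Proof.
move=> fc hc z.
exact: (@cvgD _ R[i]^o _ (nbhs z) (nbhs_filter z) f h _ _ (fc z) (hc z)).
Qed.

Lemma circle_contM f h :
  circle_cont f -> circle_cont h -> circle_cont (fun z => f z * h z).
Proof.
move=> fc hc z.
exact: (@cvgM R[i] _ (nbhs z) (nbhs_filter z) f h _ _ (fc z) (hc z)).
Qed.

Lemma circle_cont_conj f : circle_cont f -> circle_cont (fun z => (f z)^*).
Proof.
move=> /circle_contP fc; apply/circle_contP => z e e0.
apply: filterS (fc z e e0) => w.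
by rewrite -rmorphB normc_conj.
Qed.

Lemma circle_cont_pow k : circle_cont (fun z : circle R => (\val z : R[i]) ^+ k).
Proof.
elim: k => [|k IH]; first exact: circle_cont_cst.
under [X in circle_cont X]eq_fun do rewrite exprS.
exact: circle_contM circle_cont_val IH.
Qed.

Lemma circle_cont_trig_poly (c : nat -> R[i]) n :
  circle_cont (fun z : circle R => trig_poly c n (\val z)).
Proof.
elim: n => [|n IH].
  have -> : (fun z : circle R => trig_poly c 0 (\val z)) = (fun=> 0).
    by apply/funext => z; rewrite /trig_poly big_ord0.
  exact: circle_cont_cst.
have -> : (fun z : circle R => trig_poly c n.+1 (\val z)) =
    (fun z => trig_poly c n (\val z) + c n * (\val z : R[i]) ^+ n).
  by apply/funext => z; rewrite /trig_poly big_ord_recr.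
exact: (@circle_contD _ _ IH
  (@circle_contM _ _ (@circle_cont_cst (c n)) (@circle_cont_pow n))).
Qed.

(** Functions of this form are stable under conjugation and under products with a
    common [B], and they contain the polynomials in [U] and the spectral projections;
    they are the only functions of [U] that the argument uses. *)
Definition cut h B : circle R -> R[i] := fun z => h z * (z \in B)%:R.

Definition admissible_cut h B : Prop :=
  [/\ circle_cont h, exists M : R, forall z, normc (h z) <= M &
      measurable (B : set (borel (circle R)))].

Lemma bounded_borel_cut h B :
  admissible_cut h B -> bounded_borel (cut h B).
Proof.
move=> [hc [M hM] mB]; split; last first.
  exists M => z; rewrite /cut -[leLHS]/((normc _)%:C) lecR.
  apply: le_trans (hM z); case: (z \in B); first by rewrite mulr1.
  by rewrite mulr0 Normc.normc0 normc_ge0.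
apply: (@measurability _ _ (borel (circle R)) (borel R[i]^o) setT (cut h B)
  (@open R[i]^o) erefl) => _ [V oV <-]; rewrite setTI.
have mhV : measurable (h @^-1` V : set (borel (circle R))).
  apply: measurable_open_circle.
  by apply: (open_comp (f := h : circle R -> R[i]^o)).
have [V0|V0] := pselect (V 0).
  have -> : cut h B @^-1` V = (h @^-1` V `&` B) `|` ~` B.
    apply/seteqP; split => z; rewrite /cut /=.
      case: (boolP (z \in B)); rewrite ?inE ?notin_setE => zB.
        by rewrite mulr1; left.
      by right.
    case: (boolP (z \in B)); rewrite ?inE ?notin_setE => zB.
      by rewrite mulr1 => -[[]//|].
    by rewrite mulr0.
  by apply: measurableU; [exact: measurableI|exact: measurableC].
have -> : cut h B @^-1` V = h @^-1` V `&` B.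
  apply/seteqP; split => z; rewrite /cut /=.
    case: (boolP (z \in B)); rewrite ?inE ?notin_setE => zB; first by rewrite mulr1.
    by rewrite mulr0.
  by move=> [hV /mem_set ->]; rewrite mulr1.
exact: measurableI.
Qed.

Lemma measurable_Re f : bounded_borel f ->
  measurable_fun setT ((fun z => complex.Re (f z)) : borel (circle R) -> R).
Proof.
move=> [mf _].
apply: (measurability _ (RGenOInfty.measurableE R)) => _ [_ [x ->] <-].
rewrite setTI.
have oV : open ([set w : R[i]^o | x < complex.Re w]).
  rewrite openE => w /= xw; apply/nbhs_ballP; exists (complex.Re w - x)%:C.
    by rewrite /= ltcR subr_gt0.
  move=> v; rewrite -ball_normE /= => wv.
  have := le_lt_trans (normc_ge_Re (w - v)) wv; rewrite ltcR.
  rewrite raddfB/= => /ltr_normlW; rewrite /=; lra.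
have := mf measurableT [set w : R[i]^o | x < complex.Re w] (sub_sigma_algebra oV).
rewrite setTI; congr measurable; apply/seteqP.
by split => z /=; rewrite in_itv/= andbT.
Qed.

End BoundedBorel.

(** * Spectral localization *)

Section Calculus.
Variables (R : realType) (H : completeNormedModType R[i]).
Variable dot : {dot H for conjC}.
Variables (U : {linear H -> H}) (psi : H).
Variable mu : {finite_measure set (borel (circle R)) -> \bar R}.
Variable F : (circle R -> R[i]) -> H -> H.
Hypothesis calc : borel_functional_calculus dot U F.
Hypothesis spec : forall f, bounded_borel f ->
  inner dot psi (F f psi) = cintegral mu f.
Local Notation normc := (@Normc.normc R).
Local Notation "<[ x | y ]>" := (inner dot x y) (at level 8).
Implicit Types (B : set (circle R)) (c : nat -> R[i]).

Definition cut_poly c n B := cut (fun z : circle R => trig_poly c n (\val z)) B.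
Definition cut_pow k B := cut (fun z : circle R => (\val z : R[i]) ^+ k) B.
Definition spectral_part B : H := F (cut_pow 0 B) psi.

Lemma cut_poly_bounded c n B : measurable (B : set (borel (circle R))) ->
  admissible_cut (fun z => trig_poly c n (\val z)) B.
Proof.
move=> mB; split; [exact: circle_cont_trig_poly| |exact: mB].
exists (\sum_(k < n) normc (c k)) => z.
apply: le_trans (normc_sum n (fun k => c k * _)) _.
by apply: ler_sum => k _; rewrite Normc.normcM normcX circle_normc expr1n mulr1.
Qed.

Lemma cut_pow_bounded k B : measurable (B : set (borel (circle R))) ->
  admissible_cut (fun z => (\val z : R[i]) ^+ k) B.
Proof.
move=> mB; split; [exact: circle_cont_pow| |exact: mB].
by exists 1 => z; rewrite normcX circle_normc expr1n.
Qed.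

Lemma bounded_borel_pow k B : measurable (B : set (borel (circle R))) ->
  bounded_borel (cut_pow k B).
Proof. by move=> mB; apply: bounded_borel_cut; exact: cut_pow_bounded. Qed.

Lemma bounded_borel_poly c n B : measurable (B : set (borel (circle R))) ->
  bounded_borel (cut_poly c n B).
Proof. by move=> mB; apply: bounded_borel_cut; exact: cut_poly_bounded. Qed.

Lemma calculus_pow k B x : measurable (B : set (borel (circle R))) ->
  F (cut_pow k B) x = evolution U (F (cut_pow 0 B) x) k.
Proof.
move=> mB; elim: k => // k IH.
have -> : cut_pow k.+1 B = (fun z => \val z * cut_pow k B z).
  by apply/funext => z; rewrite /cut_pow /cut exprS mulrA.
have bbv : bounded_borel (fun z : circle R => \val z : R[i]).
  have -> : (fun z : circle R => \val z : R[i]) = cut_pow 1 setT.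
    by apply/funext => z; rewrite /cut_pow /cut in_setT mulr1 expr1.
  exact: bounded_borel_pow.
by rewrite (bfc_mul calc)//; [rewrite (bfc_id calc) IH|exact: bounded_borel_pow].
Qed.

Lemma calculus_poly c n B x : measurable (B : set (borel (circle R))) ->
  F (cut_poly c n B) x = \sum_(k < n) c k *: evolution U (F (cut_pow 0 B) x) k.
Proof.
move=> mB; elim: n => [|n IH].
  have b0 := bounded_borel_poly c 0 mB.
  have := bfc_comb calc (-1) x b0 b0; rewrite scaleN1r addNr big_ord0 => <-.
  congr (F _ x); apply/funext => z; rewrite /cut_poly /cut /trig_poly big_ord0.
  by rewrite mul0r mulr0 addr0.
have -> : cut_poly c n.+1 B = (fun z => c n * cut_pow n B z + cut_poly c n B z).
  apply/funext => z; rewrite /cut_poly /cut /trig_poly big_ord_recr/= mulrDl.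
  by rewrite addrC mulrA.
rewrite (bfc_comb calc); [|exact: bounded_borel_pow|exact: bounded_borel_poly].
by rewrite big_ord_recr/= IH calculus_pow// addrC.
Qed.

(** Since the adjoint of [F f] is [F] of the conjugate of [f], multiplicativity turns
    the squared norm of [F f psi] into the inner product of [psi] with
    [F (|f| ^ 2) psi]. *)
Lemma sqnorm_calculus (h : circle R -> R[i]) B :
  admissible_cut h B ->
  measurable_fun setT ((fun z => normc (cut h B z) ^+ 2) : borel (circle R) -> R) /\
  sqnorm dot (F (cut h B) psi) = \int[mu]_z (normc (cut h B z) ^+ 2).
Proof.
move=> hB; have [hc [M hM] mB] := hB.
pose f := cut h B.
have conjE : (fun z => conjC (f z)) = cut (fun z => (h z)^*) B.
  by apply/funext => z; rewrite /f /cut rmorphM rmorph_nat.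
have hB' : admissible_cut (fun z => (h z)^*) B.
  split; [exact: (@circle_cont_conj _ _ hc)| |exact: mB].
  by exists M => z; rewrite normc_conj.
have bf := bounded_borel_cut hB.
have bf' : bounded_borel (fun z => conjC (f z)).
  by rewrite conjE; exact: bounded_borel_cut.
have bff : bounded_borel (fun z => conjC (f z) * f z).
  have -> : (fun z => conjC (f z) * f z) = cut (fun z => (h z)^* * h z) B.
    apply/funext => z; rewrite /f /cut rmorphM rmorph_nat mulrACA -natrM.
    by rewrite mulnb andbb.
  apply: bounded_borel_cut; split; [| |exact: mB].
    exact: (@circle_contM _ _ _ (@circle_cont_conj _ _ hc) hc).
  exists (M ^+ 2) => z; rewrite Normc.normcM normc_conj -expr2.
  by rewrite lerXn2r ?nnegrE ?normc_ge0//; apply: le_trans (hM z); exact: normc_ge0.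
have ReE : (fun z => complex.Re (conjC (f z) * f z)) = (fun z => normc (f z) ^+ 2).
  by apply/funext => z; rewrite mulrC mulc_conj.
split; first by rewrite -[X in measurable_fun _ X]ReE; exact: measurable_Re.
have FE : F f psi = F (fun z => conjC (conjC (f z))) psi.
  by congr (F _ psi); apply/funext => z; rewrite conjCK.
by rewrite /sqnorm {1}FE -(bfc_adj calc)// -(bfc_mul calc)// spec// /cintegral/= ReE.
Qed.

Lemma inner_spectral_part B : measurable (B : set (borel (circle R))) ->
  <[psi | spectral_part B]> = (fine (mu B))%:C.
Proof.
move=> mB; rewrite spec; last exact: bounded_borel_pow.
have E1 : (fun z => complex.Re (cut_pow 0 B z)) = \1_B.
  by apply/funext => z; rewrite /cut_pow /cut expr0 mul1r indicE; case: (z \in B).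
have E0 : (fun z => complex.Im (cut_pow 0 B z)) = cst 0.
  by apply/funext => z; rewrite /cut_pow /cut expr0 mul1r; case: (z \in B).
rewrite /cintegral; congr (_ +i* _).
  rewrite (_ : (fun z => _) = \1_B)//.
  by rewrite /Rintegral integral_indic// setIT.
rewrite (_ : (fun z => _) = cst 0)//.
by rewrite /Rintegral integral0_eq.
Qed.

Lemma sqnorm_spectral_part B : measurable (B : set (borel (circle R))) ->
  sqnorm dot (spectral_part B) = fine (mu B).
Proof.
move=> mB; have [_ ->] := sqnorm_calculus (cut_pow_bounded 0 mB).
rewrite /Rintegral -[in RHS](setIT B) -integral_indic//.
congr fine; apply: eq_integral => z _; rewrite /cut expr0 mul1r indicE.
by case: (z \in B); rewrite ?Normc.normc1 ?Normc.normc0 ?expr1n ?expr0n.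
Qed.

(** The left-hand side is the integral over the bad set of the squared modulus of the
    polynomial with coefficients [c].  On each bad arc that square is at most
    [sample_bound], and the measure of the arc is less than [K ^ - s]. *)
Lemma sqnorm_bad_poly (s : R) (K : nat) c : (0 < K)%N ->
  sqnorm dot (\sum_(k < K) c k *: evolution U (spectral_part (bad_set mu s K)) k) <=
  (2 + 8 * pi ^+ 2) * K%:R * K%:R `^ (- s) * \sum_(k < K) normc (c k) ^+ 2.
Proof.
move=> K0; set B := bad_set mu s K.
have mB : measurable (B : set (borel (circle R))) by exact: measurable_bad_set.
have [mf ->] : measurable_fun setT ((fun z => normc (cut_poly c K B z) ^+ 2) :
      borel (circle R) -> R) /\
    sqnorm dot (\sum_(k < K) c k *: evolution U (spectral_part B) k) =
    \int[mu]_z (normc (cut_poly c K B z) ^+ 2).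
  rewrite /spectral_part -calculus_poly//.
  exact/sqnorm_calculus/cut_poly_bounded.
pose bad i := (mu (grid_arc K i) < (K%:R `^ - s)%:E)%E.
pose a i := if bad i then sample_bound c K i else 0.
have sb0 i : 0 <= sample_bound c K i.
  apply: addr_ge0; first by rewrite mulr_ge0 ?sqr_ge0.
  apply: mulr_ge0; first by rewrite mulr_ge0 ?sqr_ge0.
  by rewrite mulr_ge0// sumr_ge0// => k _; exact: sqr_ge0.
have a0 (i : nat) : 0 <= a i by rewrite /a; case: (bad i).
pose g (i : nat) (z : borel (circle R)) : \bar R := (a i * \1_(grid_arc K i) z)%:E.
have mg i : measurable_fun [set: borel (circle R)] (g i).
  apply/measurable_EFinP; apply: measurable_funM => //.
  by apply: measurable_indic; exact: measurable_arc.
have g0 i z : (0 <= g i z)%E by rewrite lee_fin mulr_ge0.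
have le1 : (\int[mu]_z (normc (cut_poly c K B z) ^+ 2)%:E <=
    ((2 + 8 * pi ^+ 2) * K%:R * K%:R `^ (- s) *
      \sum_(k < K) normc (c k) ^+ 2)%:E)%E.
  apply: (@le_trans _ _ (\int[mu]_z (\sum_(i < K) g i z))%E).
    apply: ge0_le_integral => //.
    - by move=> z _; rewrite lee_fin sqr_ge0.
    - exact/measurable_EFinP.
    - by apply: emeasurable_sum => i; exact: mg.
    move=> z _; rewrite /cut_poly /cut.
    have [zB|zB] := boolP (z \in B); last first.
      by rewrite mulr0 Normc.normc0 expr0n/= sume_ge0.
    rewrite mulr1; move: zB; rewrite inE => -[i [iK ibad] zi].
    have [t tK ->] := grid_arcP zi.
    rewrite (bigD1 (Ordinal iK))//=; apply: (@le_trans _ _ (g i z)); last first.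
      by rewrite leeDl// sume_ge0.
    rewrite /g indicE mem_set// mulr1 lee_fin /a /bad ibad.
    exact: trig_poly_sample.
  rewrite ge0_integral_sum//.
  apply: (@le_trans _ _ (\sum_(i < K) (sample_bound c K i * K%:R `^ (- s))%:E)%E).
    apply: lee_sum => i _; rewrite /g.
    under eq_integral do rewrite EFinM.
    rewrite ge0_integralZl//; [|by apply/measurable_EFinP/measurable_indic;
      exact: measurable_arc|by rewrite lee_fin].
    rewrite integral_indic//; last exact: measurable_arc.
    rewrite setIT /a; case: ifPn => [ib|_]; last first.
      by rewrite mul0e lee_fin mulr_ge0 ?powR_ge0.
    by rewrite EFinM; apply: lee_wpmul2l; [rewrite lee_fin|exact: ltW].
  rewrite sumEFin lee_fin -mulr_suml mulrAC ler_wpM2r ?powR_ge0//.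
  exact: sum_sample_bound.
rewrite -lee_fin; apply: (le_trans _ le1).
rewrite /Rintegral fineK// ge0_fin_numE; first by rewrite (le_lt_trans le1)// ltry.
by apply: integral_ge0 => z _; rewrite lee_fin sqr_ge0.
Qed.

End Calculus.

(** * Moments control the mass of the bad set *)

Lemma absz_shift (z : int) (N : nat) : (absz z <= N)%N ->
  (absz (z + N%:Z)%R < N.*2.+1)%N /\ z = (absz (z + N%:Z)%R)%:Z - N%:Z.
Proof. by move=> zN; split; lia. Qed.

Section LatticeBox.
Variable d : nat.
Implicit Types n : {ffun 'I_d -> int}.

(** The cube of the sites with coordinates between [-N] and [N], as a translate of a
    finite type of functions whose cardinal is known. *)
Definition lattice_box (N : nat) : seq {ffun 'I_d -> int} :=
  [seq [ffun i => (f i : nat)%:Z - N%:Z] | f : {ffun 'I_d -> 'I_(N.*2.+1)}].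

Lemma size_lattice_box N : size (lattice_box N) = (N.*2.+1 ^ d)%N.
Proof. by rewrite size_map -cardE card_ffun !card_ord. Qed.

Lemma mem_lattice_box N n : (norm1 n <= N)%N -> n \in lattice_box N.
Proof.
move=> nN; apply/mapP; exists [ffun i => inord (absz (n i + N%:Z))].
  by rewrite mem_enum.
apply/ffunP => i; rewrite !ffunE.
have : (absz (n i) <= N)%N.
  by apply: leq_trans nN; rewrite /norm1 (bigD1 i)//= leq_addr.
by move=> /absz_shift[lt nE]; rewrite inordK//; exact: nE.
Qed.

End LatticeBox.

Section Transport.
Variables (R : realType) (H : completeNormedModType R[i]).
Variable dot : {dot H for conjC}.
Hypothesis normE : forall x : H, `|x| ^+ 2 = inner dot x x.
Variables (U : {linear H -> H}) (unitaryU : unitary dot U).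
Variables (psi : H) (psi1 : `|psi| = 1).
Variables (d : nat) (A : set {ffun 'I_d -> int}).
Variables (phi : {ffun 'I_d -> int} -> H) (basis : orthonormal_basis dot A phi).
Variable mu : {finite_measure set (borel (circle R)) -> \bar R}.
Variable F : (circle R -> R[i]) -> H -> H.
Hypothesis calc : borel_functional_calculus dot U F.
Hypothesis spec : forall f, bounded_borel f ->
  inner dot psi (F f psi) = cintegral mu f.
Variables (p : R) (p_gt0 : 0 < p).
Local Notation normc := (@Normc.normc R).
Local Notation "<[ x | y ]>" := (inner dot x y) (at level 8).
Local Notation sq := (sqnorm dot).

Lemma inner_evolution x y k : <[evolution U x k | evolution U y k]> = <[x | y]>.
Proof. by elim: k => //= k IH; rewrite unitaryU.1. Qed.

Lemma sqnorm_evolution x k : sq (evolution U x k) = sq x.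
Proof. by rewrite /sqnorm inner_evolution. Qed.

Lemma sqnorm_psi : sq psi = 1.
Proof. by rewrite /sqnorm -normE psi1 expr1n. Qed.

Definition sites (N : nat) : seq {ffun 'I_d -> int} :=
  [seq n <- undup (lattice_box d N) | `[< A n >]].

Lemma sitesA N n : n \in sites N -> A n.
Proof. by rewrite mem_filter => /andP[/asboolP]. Qed.

Lemma uniq_sites N : uniq (sites N).
Proof. by rewrite filter_uniq// undup_uniq. Qed.

Lemma size_sites N : (size (sites N) <= N.*2.+1 ^ d)%N.
Proof.
rewrite -size_lattice_box; apply: leq_trans (size_undup _).
by rewrite size_filter count_size.
Qed.

Lemma sites_far N n : A n -> n \notin sites N -> (N < norm1 n)%N.
Proof.
move=> nA; apply: contraR; rewrite -leqNgt => nN.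
by rewrite mem_filter mem_undup mem_lattice_box// andbT; exact/asboolP.
Qed.

Lemma orthonormal_sites N : orthonormal_seq dot phi (sites N).
Proof.
split; first exact: uniq_sites.
by move=> m n /sitesA mA /sitesA nA; exact: basis.1.
Qed.

Lemma tail_le_moment N k :
  ((N.+1%:R `^ p *
      sq (evolution U psi k - proj dot phi (sites N) (evolution U psi k)))%:E
   <= moment dot A phi U psi p k)%E.
Proof.
apply: (@residual_le_esum _ _ dot normE _ phi A _ (fun n => (norm1 n)%:R `^ p + 1)).
- exact: basis.1.
- exact: basis.2.
- exact: uniq_sites.
- exact: sitesA.
- by rewrite powR_gt0.
move=> n nA /(sites_far nA) nN; rewrite ler_wpDr// ge0_ler_powR ?nnegrE ?(ltW p_gt0)//.
by rewrite ler_nat.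
Qed.

(** The moment dominates the squared norm of the evolved state: take no site in
    [residual_le_esum]. *)
Lemma moment_ge1 k : (1 <= moment dot A phi U psi p k)%E.
Proof.
have := @residual_le_esum _ _ dot normE _ phi A [::] (fun n => (norm1 n)%:R `^ p + 1) 1
  (evolution U psi k) basis.1 basis.2.
rewrite /proj big_nil subr0 mul1r sqnorm_evolution sqnorm_psi; apply => //.
by move=> n _ _; rewrite lerDr powR_ge0.
Qed.

(** With [x] the spectral part of [psi] on the bad set, the mass of the bad set is the
    inner product of [U^k x] and [U^k psi] for every [k].  Split it by
    [inner_split_le] along the sites within distance [N]: there, [U^k x] is small on
    average in [k] by [dual_bound], and elsewhere [U^k psi] is controlled by its
    moment. *)
Lemma bad_mass_bound s K N S : (0 < K)%N ->
  (\sum_(0 <= k < K) moment dot A phi U psi p k <= S%:E)%E ->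
  fine (mu (bad_set mu s K)) ^+ 2 * K%:R * N.+1%:R `^ p <=
  2 * ((N.*2.+1 ^ d)%:R * ((2 + 8 * pi ^+ 2) * K%:R * K%:R `^ (- s))) * N.+1%:R `^ p
   + 2 * S.
Proof.
move=> K0 momS; set B := bad_set mu s K; set m := fine _.
set D := (2 + 8 * pi ^+ 2) * K%:R * _; set W := N.+1%:R `^ p.
have mB : measurable (B : set (borel (circle R))) by exact: measurable_bad_set.
pose x := spectral_part psi F B.
have m0 : 0 <= m by rewrite fine_ge0.
have W0 : 0 < W by rewrite powR_gt0.
have D0 : 0 <= D by rewrite !mulr_ge0 ?powR_ge0// addr_ge0// mulr_ge0// sqr_ge0.
have xm : sq x = m by exact: (sqnorm_spectral_part calc spec mB).
have ip k : normc <[evolution U x k | evolution U psi k]> ^+ 2 = m ^+ 2.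
  rewrite inner_evolution innerC normc_conj (inner_spectral_part spec mB).
  by rewrite /= expr0n addr0 sqr_sqrtr// sqr_ge0.
have m1 : m <= 1.
  have := cauchy_schwarz dot x psi; have := ip 0%N; rewrite /= => ->.
  rewrite xm sqnorm_psi mulr1 => mm; nra.
pose r k := sq (evolution U psi k - proj dot phi (sites N) (evolution U psi k)).
pose q k := coef_mass dot phi (sites N) (evolution U x k).
have r0 k : 0 <= r k by exact: sqnorm_ge0.
have step k : m ^+ 2 <= 2 * q k + 2 * r k.
  have := inner_split_le (orthonormal_sites N) (evolution U x k) (evolution U psi k).
  rewrite ip !sqnorm_evolution sqnorm_psi mulr1 xm -/(r k) -/(q k).
  have := r0 k; nra.
have sumr : \sum_(k < K) W * r k <= S.
  rewrite -lee_fin; apply: le_trans momS; rewrite big_mkord -sumEFin.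
  by apply: lee_sum => k _; exact: tail_le_moment.
have sumq : \sum_(k < K) q k <= (N.*2.+1 ^ d)%:R * D.
  rewrite /q /coef_mass exchange_big/=.
  apply: (@le_trans _ _ (\sum_(n <- sites N) D)).
    rewrite big_seq [leRHS]big_seq; apply: ler_sum => n nN.
    apply: (dual_bound (dot := dot) D0).
      by move=> c; exact: (sqnorm_bad_poly calc spec).
    by rewrite /sqnorm ((orthonormal_sites N).2 _ _ nN nN) eqxx.
  rewrite big_const_seq count_predT iter_addr_0 -[_ *+ _]mulr_natl ler_wpM2r//.
  by rewrite ler_nat size_sites.
have : \sum_(k < K) m ^+ 2 <= \sum_(k < K) (2 * q k + 2 * r k).
  by apply: ler_sum => k _; exact: step.
rewrite sumr_const card_ord big_split/= -!mulr_sumr.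
move: sumr; rewrite -mulr_sumr.
set Q := \sum_(k < K) q k; set P := \sum_(k < K) r k => sumr.
rewrite -[_ *+ K]mulr_natr => le1.
have : m ^+ 2 * K%:R * W <= (2 * Q + 2 * P) * W by rewrite ler_wpM2r// ltW.
have : Q * W <= (N.*2.+1 ^ d)%:R * D * W by rewrite ler_wpM2r// ltW.
lra.
Qed.

End Transport.

(** * Asymptotic bookkeeping *)

Section Asymptotics.
Variable R : realType.
Local Notation normc := (@Normc.normc R).

Lemma limn_esup_lt_eventually (u : nat -> \bar R) (b : \bar R) :
  (limn_esup u < b)%E -> exists K0, forall K, (K0 <= K)%N -> (u K <= b)%E.
Proof.
move=> /ereal_inf_lt[_ [V [K0 _ VK] <-] supV]; exists K0 => K K0K.
apply: le_trans (ltW supV); apply: ereal_sup_ubound.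
by exists K => //; exact: VK.
Qed.

Lemma limn_esup_ge0 (u : nat -> \bar R) (n : nat) :
  (forall K, (n <= K)%N -> (0 <= u K)%E) -> (0 <= limn_esup u)%E.
Proof.
move=> u0; apply: le_ereal_inf_tmp => _ [V [K0 _ VK] <-].
apply: (@le_trans _ _ (u (maxn n K0))); first by rewrite u0// leq_maxl.
by apply: ereal_sup_ubound; exists (maxn n K0) => //; apply: VK; exact: leq_maxr.
Qed.

Lemma ln_nat_gt0 (K : nat) : (2 <= K)%N -> 0 < ln K%:R :> R.
Proof. by move=> K2; rewrite ln_gt0// ltr1n. Qed.

Lemma growth_of_exponent (M : \bar R) (p b : R) (K : nat) :
  (2 <= K)%N -> 0 < p -> (0 <= M)%E ->
  (lne M / (p * ln K%:R)%:E <= b%:E)%E -> (M <= (K%:R `^ (p * b))%:E)%E.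
Proof.
move=> K2 p0 M0; have c0 : 0 < p * ln K%:R by rewrite mulr_gt0// ln_nat_gt0.
rewrite inver gt_eqF// lee_pdivrMr// -EFinM => le_lne_M.
have P0 : 0 < K%:R `^ (p * b) by rewrite powR_gt0// ltr0n (leq_trans _ K2).
have lneP : lne (K%:R `^ (p * b))%:E = (b * (p * ln K%:R))%:E.
  by rewrite lne_EFin// ln_powR; congr _%:E; ring.
by move: le_lne_M; rewrite -lneP lee_lne// in_itv/= ?M0 ?leey// lee_fin ltW.
Qed.

(** With [N] the integer part of [K ^ b'], the number of sites is at most a multiple of
    [K ^ (d * b')], against the decay [K ^ - s], and [N.+1 ^ p] is at least
    [K ^ (p * b')], against the growth [K ^ (p * b)]. *)
Lemma power_balance (d N K : nat) (b b' s p eps m E : R) :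
  (0 < K)%N -> 0 < p -> 0 <= b' -> 0 <= E ->
  N%:R <= K%:R `^ b' < N.+1%:R ->
  eps <= s - d%:R * b' -> eps <= p * (b' - b) ->
  m ^+ 2 * K%:R * N.+1%:R `^ p <=
    2 * ((N.*2.+1 ^ d)%:R * (E * K%:R * K%:R `^ (- s))) * N.+1%:R `^ p
    + 2 * (K%:R * K%:R `^ (p * b)) ->
  m ^+ 2 <= (2 * 3 ^+ d * E + 2) * K%:R `^ (- eps).
Proof.
move=> K0 p0 b'0 E0 /andP[NX XN] eps1 eps2.
have K1 : 1 <= K%:R :> R by rewrite ler1n.
have Kp : 0 < K%:R :> R by rewrite ltr0n.
set X := K%:R `^ b' in NX XN.
have X1 : 1 <= X by rewrite -[1](powRr0 (K%:R : R)) ler_powR.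
set W := N.+1%:R `^ p; have W0 : 0 < W by rewrite powR_gt0.
have XW : K%:R `^ (p * b') <= W.
  by rewrite mulrC powRrM ge0_ler_powR ?nnegrE ?powR_ge0 ?(ltW p0)// ltW.
have box_le : (N.*2.+1 ^ d)%:R * K%:R `^ (- s) <= 3 ^+ d * K%:R `^ (- eps).
  apply: (@le_trans _ _ (3 ^+ d * (X ^+ d * K%:R `^ (- s)))).
    rewrite mulrA -exprMn ler_wpM2r ?powR_ge0// natrX lerXn2r ?nnegrE//.
      by rewrite mulr_ge0// (le_trans _ X1).
    by rewrite -natr1 -muln2 natrM; lra.
  rewrite ler_wpM2l ?exprn_ge0//.
  rewrite -powR_mulrn ?powR_ge0// -powRrM -powRD ?(gt_eqF Kp) ?implybT//.
  by apply: ler_powR => //; lra.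
have tail_le : K%:R `^ (p * b) <= W * K%:R `^ (- eps).
  apply: (@le_trans _ _ (K%:R `^ (p * b') * K%:R `^ (- eps))).
    rewrite -powRD ?(gt_eqF Kp) ?implybT//.
    by apply: ler_powR => //; lra.
  by rewrite ler_wpM2r ?powR_ge0.
move=> le_m.
rewrite -(ler_pM2r Kp) -(ler_pM2r W0); apply: le_trans le_m _.
set Y := K%:R `^ (- eps) in box_le tail_le *.
have KW : 0 <= K%:R * W by rewrite mulr_ge0 ?ltW.
have : 2 * E * (K%:R * W) * ((N.*2.+1 ^ d)%:R * K%:R `^ (- s)) <=
       2 * E * (K%:R * W) * (3 ^+ d * Y).
  by rewrite ler_wpM2l// mulr_ge0// mulr_ge0.
have : 2 * K%:R * K%:R `^ (p * b) <= 2 * K%:R * (W * Y).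
  by rewrite ler_wpM2l// mulr_ge0// ltW.
lra.
Qed.

Lemma nneseries_geometric (u : nat -> R) (c q : R) :
  0 <= c -> 0 < q < 1 -> (forall j, 0 <= u j <= c * q ^+ j) ->
  (\sum_(0 <= j <oo) (u j)%:E < +oo)%E.
Proof.
move=> c0 /andP[q0 q1] uq.
apply: (@le_lt_trans _ _ (c / (1 - q))%:E); last exact: ltry.
apply: lime_le.
  by apply: is_cvg_nneseries => j _ _; rewrite lee_fin; case/andP: (uq j).
apply: nearW => n; rewrite sumEFin lee_fin.
apply: (@le_trans _ _ (series (geometric c q) n)).
  by apply: ler_sum => j _; case/andP: (uq j).
by apply: geometric_le_lim; rewrite // ger0_norm// ltW.
Qed.

(** Increasing the constant by [M / q ^+ j0] absorbs the terms before [j0]. *)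
Lemma eventually_geometric (u : nat -> R) (c q M : R) (j0 : nat) :
  0 <= c -> 0 < q < 1 -> (forall j, 0 <= u j <= M) ->
  (forall j, (j0 <= j)%N -> u j <= c * q ^+ j) ->
  (\sum_(0 <= j <oo) (u j)%:E < +oo)%E.
Proof.
move=> c0 q01 uM ule; have /andP[q0 q1] := q01.
have M0 : 0 <= M by have /andP[] := uM 0%N; exact: le_trans.
have qj0 : 0 < q ^+ j0 by rewrite exprn_gt0.
have c'0 : 0 <= M / q ^+ j0 by rewrite divr_ge0// ltW.
apply: (@nneseries_geometric u (c + M / q ^+ j0) q) => //.
  by rewrite addr_ge0.
move=> j; have /andP[u0 uj] := uM j; rewrite u0/=.
have qj : 0 <= q ^+ j by rewrite exprn_ge0// ltW.
rewrite mulrDl; have [j0j|jj0] := leqP j0 j.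
  by rewrite ler_wpDr ?ule// mulr_ge0.
apply: le_trans uj _; rewrite ler_wpDl ?mulr_ge0//.
rewrite mulrAC ler_pdivlMr// ler_wpM2l//.
by rewrite ler_wiXn2l ?(ltW q0) ?(ltW q1) ?(ltnW jj0).
Qed.

End Asymptotics.

(** * Conclusion *)

Section Conclusion.
Variables (R : realType) (H : completeNormedModType R[i]).
Variable dot : {dot H for conjC}.
Hypothesis normE : forall x : H, `|x| ^+ 2 = inner dot x x.
Variables (U : {linear H -> H}) (unitaryU : unitary dot U).
Variables (psi : H) (psi1 : `|psi| = 1).
Variables (d : nat) (A : set {ffun 'I_d -> int}).
Variables (phi : {ffun 'I_d -> int} -> H) (basis : orthonormal_basis dot A phi).
Variable mu : {finite_measure set (borel (circle R)) -> \bar R}.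
Hypothesis spec : spectral_measure dot U psi mu.
Variables (p : R) (p_gt0 : 0 < p).
Local Notation beta := (upper_transport_exponent dot A phi U psi p).

Lemma averaged_moment_ge1 K : (0 < K)%N ->
  (1 <= averaged_moment dot A phi U psi p K)%E.
Proof.
move=> K0; have K0' : (0 : R) < K%:R by rewrite ltr0n.
rewrite /averaged_moment inver gt_eqF// lee_pdivlMr// mul1e.
rewrite big_mkord; apply: (@le_trans _ _ (\sum_(k < K) 1)%E).
  by rewrite sumEFin lee_fin sumr_const card_ord.
by apply: lee_sum => k _; exact: moment_ge1.
Qed.

Lemma upper_transport_exponent_ge0 : (0 <= beta)%E.
Proof.
apply: (@limn_esup_ge0 _ _ 2) => K K2.
rewrite mule_ge0 ?lne_ge0 ?averaged_moment_ge1 ?(leq_trans _ K2)//.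
by rewrite inve_ge0 lee_fin mulr_ge0 ?ltW// ln_nat_gt0.
Qed.

Lemma moment_sum_le (b : R) : (beta < b%:E)%E -> exists K0, forall K, (K0 <= K)%N ->
  (\sum_(0 <= k < K) moment dot A phi U psi p k <= (K%:R * K%:R `^ (p * b))%:E)%E.
Proof.
move=> /limn_esup_lt_eventually[K0 K0P]; exists (maxn 2 K0) => K.
rewrite geq_max => /andP[K2 K0K]; have K1 := leq_trans (isT : 1 <= 2)%N K2.
have K0' : (0 : R) < K%:R by rewrite ltr0n.
have av0 : (0 <= averaged_moment dot A phi U psi p K)%E.
  exact: (le_trans _ (averaged_moment_ge1 K1)).
have := growth_of_exponent K2 p_gt0 av0 (K0P _ K0K).
by rewrite {1}/averaged_moment inver gt_eqF// lee_pdivrMr// -EFinM mulrC.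
Qed.

Lemma bad_sets_summable (b b' s : R) : (beta < b%:E)%E ->
  0 <= b' -> b < b' -> d%:R * b' < s ->
  (\sum_(0 <= j <oo) mu (bad_set mu s (2 ^ j)) < +oo)%E.
Proof.
move=> beta_b b'0 bb' b's; have [F calc specF] := spec.
have [K0 K0P] := moment_sum_le beta_b.
pose eps := Num.min (s - d%:R * b') (p * (b' - b)).
have eps0 : 0 < eps by rewrite lt_min subr_gt0 b's mulr_gt0// subr_gt0.
pose E : R := 2 + 8 * pi ^+ 2.
have E0 : 0 <= E by rewrite addr_ge0// mulr_ge0// sqr_ge0.
pose C := 2 * 3 ^+ d * E + 2.
have C0 : 0 <= C by rewrite addr_ge0// !mulr_ge0.
pose m j := fine (mu (bad_set mu s (2 ^ j))).
have mB j : measurable (bad_set mu s (2 ^ j) : set (borel (circle R))).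
  exact: measurable_bad_set.
have mE j : mu (bad_set mu s (2 ^ j)) = (m j)%:E.
  by rewrite fineK// fin_num_measure.
have m0 j : 0 <= m j by rewrite fine_ge0.
under eq_eseriesr do rewrite mE.
(* [power_balance] bounds the square of the mass, hence the factor 1 / 2. *)
pose q : R := 2 `^ (- eps / 2).
have q0 : 0 < q by rewrite powR_gt0.
have q1 : q < 1.
  rewrite -[ltRHS](powRr0 (2 : R)) /q /powR pnatr_eq0/= ltr_expR mul0r.
  by rewrite pmulr_llt0 ?ln_gt0 ?ltr1n// mulNr oppr_lt0 divr_gt0.
apply: (@eventually_geometric R m (Num.sqrt C) q (fine (mu setT)) K0).
- exact: sqrtr_ge0.
- by rewrite q0.
- move=> j; rewrite m0/= -lee_fin -mE fineK ?fin_num_measure//.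
  by rewrite le_measure ?inE.
move=> j jK.
have jK2 : (K0 <= 2 ^ j)%N by rewrite (leq_trans jK)// ltnW// ltn_expl.
have K1 : (0 < 2 ^ j)%N by rewrite expn_gt0.
pose N := truncn ((2 ^ j)%:R `^ b' : R).
have NP := truncn_itv (powR_ge0 (2 ^ j)%:R b').
have := bad_mass_bound normE unitaryU psi1 basis calc specF p_gt0 s N K1 (K0P _ jK2).
move/(power_balance K1 p_gt0 b'0 E0 NP (eps := eps)).
rewrite !ge_min !lexx orbT => /(_ isT isT).
have -> : (2 ^ j)%:R `^ (- eps) = (q ^+ j) ^+ 2 :> R.
  rewrite -exprM natrX -[2 ^+ j]powR_mulrn// -powRrM.
  rewrite -[q ^+ _]powR_mulrn ?powR_ge0// -powRrM natrM.
  by congr (_ `^ _); field.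
rewrite -/C -/(m j) => mC.
have c0 : 0 <= Num.sqrt C * q ^+ j by rewrite mulr_ge0 ?sqrtr_ge0// exprn_ge0// ltW.
by rewrite -ler_sqr ?nnegrE// exprMn sqr_sqrtr.
Qed.

End Conclusion.

Theorem corollary3p24 (R : realType) (H : completeNormedModType R[i])
    (dot : {dot H for conjC}) (normE : forall x : H, `|x| ^+ 2 = inner dot x x)
    (sepH : separable_space H)
    (U : {linear H -> H}) (unitaryU : unitary dot U)
    (psi : H) (psi1 : `|psi| = 1)
    (d : nat) (d_ge1 : (1 <= d)%N)
    (A : set {ffun 'I_d -> int}) (A_index : A = @positive_orthant d \/ A = setT)
    (phi : {ffun 'I_d -> int} -> H) (basis : orthonormal_basis dot A phi)
    (mu : {finite_measure set (borel (circle R)) -> \bar R})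
    (spec : spectral_measure dot U psi mu)
    (p : R) (p_gt0 : 0 < p) :
  (upper_packing_dim mu / (d%:R)%:E <=
     upper_transport_exponent dot A phi U psi p)%E.
Proof.
have d0 : (0 : R) < d%:R by rewrite ltr0n.
have := upper_transport_exponent_ge0 normE unitaryU psi1 basis p_gt0.
case betaE : (upper_transport_exponent dot A phi U psi p) => [b| |] b0; rewrite ?leey//.
move: b0; rewrite lee_fin => b0.
rewrite inver gt_eqF// lee_pdivrMr// -EFinM; apply/lee_addgt0Pr => e e0.
rewrite -EFinD.
(* The exponents [b + e / (4 * d)] and [b + e / (2 * d)] lie strictly between [b]
   and [(b * d + e) / d]. *)
have e2d : 0 < e / (2 * d%:R) by rewrite divr_gt0// mulr_gt0.
have e4d : 0 < e / (4 * d%:R) by rewrite divr_gt0// mulr_gt0.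
have lt_e : e / (4 * d%:R) < e / (2 * d%:R).
  by rewrite ltr_pM2l// ltf_pV2 ?posrE ?mulr_gt0// ltr_pM2r// ltr_nat.
apply: upper_packing_dim_le; first by rewrite addr_ge0 ?(ltW e0)// mulr_ge0.
apply: (bad_sets_summable normE unitaryU psi1 basis spec p_gt0
  (b := b + e / (4 * d%:R)) (b' := b + e / (2 * d%:R))).
- by rewrite betaE lte_fin ltrDl.
- by rewrite addr_ge0// ltW.
- by rewrite ltrD2l.
rewrite mulrDr [d%:R * b]mulrC ltrD2l.
have -> : d%:R * (e / (2 * d%:R)) = e / 2 by field; rewrite gt_eqF.
by rewrite ltr_pdivrMr// ltr_pMr// ltr1n.
Qed.
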